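(* Let $X$ be a finite contractible simplicial complex and let $S=\{X_i\}_{i=1}^m$ be a family of $m\geq 2$ pairwise disjoint contractible subcomplexes of $X$. Let $n\geq m$. Then \[ \mathcal{S}tr(X,S,n)\simeq\bigvee_{i=1}^{f(m,n)}\mathbb{S}^{n-m}, \] where $f(m,n)=\sum_{\alpha=1}^{m-1}(-1)^{m+\alpha+1}\binom{m}{\alpha+1}\alpha^n$.
   Context: Set $X_0=X$. For $n\geq m$ let $A_{m,n}=\{(i_1,\dots,i_n)\in(\{0\}\cup[m])^n:\{i_1,\dots,i_n\}\supseteq[m]\}$, where $[m]=\{1,\dots,m\}$. The Stirling complex is the subspace of $X^n$ given by $\mathcal{S}tr(X,S,n)=\bigcup_{(i_1,\dots,i_n)\in A_{m,n}}X_{i_1}\times\cdots\times X_{i_n}$. $\mathbb{S}^k$ denotes the $k$-sphere; a wedge of $N$ copies of $\mathbb{S}^0$ is a discrete space with $N+1$ points. *)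

(* Defs.v *)
From HB Require Import structures.
From mathcomp Require Import all_boot all_order all_algebra.
From mathcomp Require Import all_classical all_reals all_analysis.
From mathcomp Require Import homotopy.

Set Implicit Arguments.
Unset Strict Implicit.
Unset Printing Implicit Defensive.

Import Order.TTheory GRing.Theory Num.Theory.
Import numFieldNormedType.Exports.

Local Open Scope classical_set_scope.
Local Open Scope ring_scope.

Definition homotopic (R : realType) (T U : topologicalType) (f g : T -> U) :=
  exists H : T * R -> U,
    [/\ {within [set: T] `*` `[0, 1], continuous H},
        forall x, H (x, 0) = f x &
        forall x, H (x, 1) = g x].

Definition homotopy_equivalent (R : realType) (T U : topologicalType) :=
  exists (f : T -> U) (g : U -> T),
    [/\ continuous f, continuous g,
        homotopic R (g \o f) idfun &
        homotopic R (f \o g) idfun].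

Definition contractible (R : realType) (T : topologicalType) :=
  exists x0 : T, homotopic R (@idfun T) (fun=> x0).

(* Finite abstract simplicial complexes.  The type V is only an ambient finite
   set of labels: the vertices of K are the v with [set v] \in K. *)
Record simplicial_complex (V : finType) := SimplicialComplex {
  faces :> {set {set V}};
  face_neq0 : forall s, s \in faces -> s != finset.set0;
  face_sub : forall s t : {set V},
    s \in faces -> t \subset s -> t != finset.set0 -> t \in faces }.

Definition subcomplex (V : finType) (L K : simplicial_complex V) : bool :=
  faces L \subset faces K.

(* Barycentric coordinates.  As V is finite, the weak (CW) topology of the
   geometric realization is the subspace topology inherited from R^V. *)
Definition realization (R : realType) (V : finType)
    (K : simplicial_complex V) : set (prod_topology (fun _ : V => R)) :=
  [set x | [/\ forall v, 0 <= x v,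
               \sum_v x v = 1 &
               finset (fun v => x v != 0) \in faces K]].

Arguments realization R {V} K.

(* |L| seen as a subset of the space |K|, for L a subcomplex of K *)
Definition subrealization (R : realType) (V : finType)
    (K L : simplicial_complex V) : set (realization R K) :=
  [set x | realization R L (\val x)].

Arguments subrealization R {V} K L.

(* 'I_m.+1 stands for {0} u [m]: ord0 is the index 0, and the indices 1..m,
   i.e. the lift ord0 j, enumerate the family indexed by 'I_m. *)
Definition with_total (X : Type) (m : nat) (S : 'I_m -> set X)
    (i : 'I_m.+1) : set X :=
  if unlift ord0 i is Some j then S j else [set: X].

Definition stirling_index (m n : nat) : set ('I_n -> 'I_m.+1) :=
  [set i | [set j | j != ord0] `<=` range i].
Arguments stirling_index m n : clear implicits.

Definition stirling_complex (X : topologicalType) (m : nat)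
    (S : 'I_m -> set X) (n : nat) : set (prod_topology (fun _ : 'I_n => X)) :=
  \bigcup_(i in stirling_index m n)
    [set x | forall k : 'I_n, with_total S (i k) (x k)].
Arguments stirling_complex {X m} S n.

Definition sphere (R : realType) (k : nat) : set 'rV[R]_k.+1 :=
  [set x | \sum_i x 0 i ^+ 2 = 1].

Arguments sphere R k : clear implicits.

Lemma sphere_base_subproof (R : realType) (k : nat) :
  (delta_mx 0 0 : 'rV[R]_k.+1) \in sphere R k.
Proof.
apply/mem_set; rewrite /sphere /= (bigD1 0) //= mxE !eqxx expr1n big1 ?addr0 //.
by move=> i /negPf i0; rewrite mxE i0 andbF expr0n.
Qed.

Definition sphere_base (R : realType) (k : nat) : sphere R k :=
  SigSub (sphere_base_subproof R k).

(* For N = 0 the library's wedge is the empty space, not a point; this does not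
   matter for N = stirling_count m n, which is positive when 2 <= m <= n. *)
Definition wedge_of_spheres (R : realType) (N k : nat) : topologicalType :=
  wedge (fun _ : 'I_N => sphere_base R k).

Definition stirling_count (m n : nat) : int :=
  \sum_(1 <= a < m) (-1) ^+ (m + a + 1) * 'C(m, a.+1)%:Z * a%:Z ^+ n.

(* Main.v *)
Require Import Defs.
From mathcomp Require Import all_boot all_order all_algebra.
From mathcomp Require Import all_classical all_reals all_analysis.
From mathcomp Require Import homotopy.
From mathcomp Require Import ring lra zify.

(* The Stirling complex consists of the x in X^n some coordinate of which lies in
   X_i, for every i.  By the homotopy extension property the pair formed by X and
   the family of the X_i can be replaced by an interval with marked points 0, ...,
   m - 1, so the question is about the cubical complex M(A, n) of those x in the
   n-cube whose coordinates exhaust A = {0, ..., m - 1}.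

   Splitting off the last coordinate writes M(A, n + 1) as the union of
   M(A, n) x [0, m - 1] and of the M(A - i, n) x {i}, i in A.  This recursion
   singles out a subcomplex D(A, n), here [core A n], obtained by removing some open
   cells of dimension n - m.  Inductively D is contractible: D(A, n + 1) retracts onto
   D(A, n) x [0, m - 1] with the contractible D(A - i, n) x {i} attached along the
   contractible D(A, n) x {i}.  Collapsing D turns M into a wedge of spheres of
   dimension n - m, one for each removed cell, and the number of these satisfies
   f(m, n + 1) = (m - 1) f(m, n) + m f(m - 1, n) with f(m, m) = m! - 1. *)

Set Implicit Arguments.
Unset Strict Implicit.
Unset Printing Implicit Defensive.

Import Order.TTheory GRing.Theory Num.Theory.
Import numFieldNormedType.Exports.
Local Open Scope classical_set_scope.
Local Open Scope ring_scope.

(** * Continuity on a subset *)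

(** The recursion works because M(A, k) lies in D(A - i, k) for every i in A: M(A, k) has dimension
    k - |A|, one less than the cells removed from M(A - i, k). Cutting one unit edge of the last
    axis per non-minimal element of A leaves one component of the line for each i in A, even if A
    has gaps, which passing to A - i creates. Everything in D(A, k + 1) above the component of i
    then lies over the contractible D(A - i, k), and can be slid to last coordinate i and contracted
    there. The recursion starts at k = |A|, where M(A, k) consists of |A|! vertices, one per
    ordering of A, and D keeps a single one. Replacing X by an interval is done once, on X, and then
    applied to each coordinate of a tuple. Membership in the Stirling complex survives this only if
    the homotopy of X keeps every X_i inside itself at all times. Homotopies therefore carry a
    condition on their tracks, and are maps on an ambient space restricted to subsets, so that
    pieces can be glued without passing through subtypes. *)

Definition cont_on (T U : topologicalType) (A : set T) (f : T -> U) :=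
  forall x, A x -> f @ within A (nbhs x) --> f x.

Section ContOn.
Context {T U : topologicalType}.
Implicit Types (A B : set T) (f : T -> U).

Lemma cont_onP A f : {within A, continuous f} <-> cont_on A f.
Proof. exact: subspace_continuousP. Qed.

Lemma cont_onT f : cont_on setT f <-> continuous f.
Proof.
split=> cf x => [V nV|_ V nV].
  have h : nbhs x (fun y => [set: T] y -> V (f y)) := cf x I V nV.
  by apply: (filterS _ h) => y; apply.
have h : nbhs x (fun y => V (f y)) := cf x V nV.
by apply: (filterS _ h).
Qed.

Lemma continuous_cont_on A f : continuous f -> cont_on A f.
Proof. by move=> cf x _; apply: cvg_trans (cf x); apply: cvg_app; exact: cvg_within. Qed.

Lemma cont_onW A B f : A `<=` B -> cont_on B f -> cont_on A f.
Proof.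
move=> AB cf x Ax; apply: cvg_trans (cf x (AB x Ax)); apply: cvg_app.
exact: within_subset.
Qed.

Lemma cont_on_near A f g x : A x -> f @ within A (nbhs x) --> f x ->
  (\forall y \near x, A y -> f y = g y) -> g @ within A (nbhs x) --> g x.
Proof.
move=> Ax cf fg; rewrite -(nbhs_singleton fg Ax); apply: cvg_trans cf.
exact: near_eq_cvg fg.
Qed.

Lemma cont_on_ext A f g : cont_on A f -> (forall x, A x -> f x = g x) -> cont_on A g.
Proof.
move=> cf fg x Ax; apply: (cont_on_near Ax (cf x Ax)).
by apply: nearW => y /fg.
Qed.

End ContOn.

Section ContOnComp.
Context {T U W : topologicalType}.
Implicit Types (A B : set T) (f : T -> U).

Lemma cont_on_comp A (B : set U) f (g : U -> W) :
  cont_on A f -> cont_on B g -> (forall x, A x -> B (f x)) ->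
  cont_on A (g \o f).
Proof.
move=> cf cg AB x Ax; apply: cvg_comp (cg _ (AB _ Ax)).
move=> V /= /(cf x Ax); rewrite /nbhs /= => H.
by apply: filterS (filterI H (withinT _ (nbhs_filter x))) => y /= [h /AB Bfy]; exact: h.
Qed.

Lemma cont_on_comp_cont A f (g : U -> W) :
  cont_on A f -> continuous g -> cont_on A (g \o f).
Proof. by move=> cf cg; apply: (@cont_on_comp A setT _ _ cf) => //; exact: continuous_cont_on. Qed.

Lemma cont_on_pair A f (g : T -> W) :
  cont_on A f -> cont_on A g -> cont_on A (fun x => (f x, g x)).
Proof. by move=> cf cg x Ax; apply: cvg_pair; [exact: cf|exact: cg]. Qed.

Lemma cont_on_cst A (y : U) : cont_on A (fun=> y).
Proof. by move=> x _; exact: cvg_cst. Qed.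

Lemma cont_on_id (A : set T) : cont_on A idfun.
Proof. by apply: continuous_cont_on => x; exact: cvg_id. Qed.

Lemma cont_on_closedU (A B C : set T) f : closed B -> closed C -> A `<=` B `|` C ->
  cont_on (A `&` B) f -> cont_on (A `&` C) f -> cont_on A f.
Proof.
have key D : closed D -> cont_on (A `&` D) f -> forall x, A x ->
    f @ within (A `&` D) (nbhs x) --> f x.
  move=> clD cf x Ax; have [Dx|nDx] := pselect (D x); first exact: cf.
  move=> V _; rewrite /= /within /=.
  have : nbhs x (~` D) by apply: open_nbhs_nbhs; split=> //; exact: closed_openC.
  by apply: filterS => y nDy [].
move=> clB clC ABC cB cC x Ax V nV.
have nB : \forall y \near x, (A `&` B) y -> V (f y) := key B clB cB x Ax V nV.
have nC : \forall y \near x, (A `&` C) y -> V (f y) := key C clC cC x Ax V nV.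
apply: (filterS _ (filterI nB nC)) => y [hB hC] Ay.
by have [Dy|Dy] := ABC _ Ay; [exact: hB|exact: hC].
Qed.

End ContOnComp.
Arguments cont_on_cst {T U} A y.
Arguments cont_on_id {T} A.
Arguments continuous_cont_on {T U} A {f} _.

Section ContOnReal.
Context {R : realType} {T : topologicalType}.
Implicit Types (A : set T) (f g : T -> R).

Lemma cont_onD A f g : cont_on A f -> cont_on A g -> cont_on A (fun x => f x + g x).
Proof. by move=> cf cg x Ax; apply: cvgD; [exact: cf|exact: cg]. Qed.

Lemma cont_onB A f g : cont_on A f -> cont_on A g -> cont_on A (fun x => f x - g x).
Proof. by move=> cf cg x Ax; apply: cvgB; [exact: cf|exact: cg]. Qed.

Lemma cont_onM A f g : cont_on A f -> cont_on A g -> cont_on A (fun x => f x * g x).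
Proof. by move=> cf cg x Ax; apply: cvgM; [exact: cf|exact: cg]. Qed.

Lemma cont_onV A f : cont_on A f -> (forall x, A x -> f x != 0) ->
  cont_on A (fun x => (f x)^-1).
Proof. by move=> cf f0 x Ax; apply: cvgV; [exact: f0|exact: cf]. Qed.

Lemma cont_on_norm A f : cont_on A f -> cont_on A (fun x => `|f x|).
Proof. by move=> cf x Ax; apply: cvg_norm; exact: cf. Qed.

Lemma cont_on_max A f g : cont_on A f -> cont_on A g ->
  cont_on A (fun x => Num.max (f x) (g x)).
Proof.
move=> cf cg; apply: (@cont_on_ext _ _ A (fun x => (f x + g x + `|f x - g x|) / 2)); last first.
  by move=> x _; case: (lerP (f x) (g x)) => h; lra.
apply: cont_onM; last exact: cont_on_cst.
by apply: cont_onD; [exact: cont_onD|apply: cont_on_norm; exact: cont_onB].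
Qed.

Lemma cont_on_min A f g : cont_on A f -> cont_on A g ->
  cont_on A (fun x => Num.min (f x) (g x)).
Proof.
move=> cf cg; apply: (@cont_on_ext _ _ A (fun x => (f x + g x - `|f x - g x|) / 2)); last first.
  by move=> x _; case: (lerP (f x) (g x)) => h; lra.
apply: cont_onM; last exact: cont_on_cst.
by apply: cont_onB; [exact: cont_onD|apply: cont_on_norm; exact: cont_onB].
Qed.

Lemma cont_on_sum (I : Type) (r : seq I) (P : pred I) A (F : I -> T -> R) :
  (forall i, P i -> cont_on A (F i)) -> cont_on A (fun x => \sum_(i <- r | P i) F i x).
Proof.
move=> cF; elim: r => [|i r IH].
  by apply: cont_on_ext (cont_on_cst A (0 : R)) _ => x _; rewrite big_nil.
have [Pi|nPi] := boolP (P i).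
  by apply: cont_on_ext (cont_onD (cF i Pi) IH) _ => x _; rewrite big_cons Pi.
by apply: cont_on_ext IH _ => x _; rewrite big_cons (negPf nPi).
Qed.

(** As [u] is continuous on [A] only, its sublevel sets need not be closed in [T], so
    [cont_on_closedU] does not apply. At a point of [A] outside one half, the nearby points of [A]
    are outside it as well. *)
Lemma cont_on_split (U : topologicalType) A (u : T -> R) (c : R) (f : T -> U) :
  cont_on A u -> cont_on (A `&` [set x | u x <= c]) f ->
  cont_on (A `&` [set x | c <= u x]) f -> cont_on A f.
Proof.
have key D (clD : closed D) : cont_on A u -> cont_on (A `&` (u @^-1` D)) f -> forall x, A x ->
    f @ within (A `&` (u @^-1` D)) (nbhs x) --> f x.
  move=> cu cf x Ax; have [Dx|nDx] := pselect (D (u x)); first exact: cf.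
  move=> V _; rewrite /= /within /=.
  have : nbhs (u x) (~` D) by apply: open_nbhs_nbhs; split=> //; exact: closed_openC.
  move/(cu x Ax) => nD; have {}nD : \forall y \near x, A y -> (~` D) (u y) := nD.
  by apply: (filterS _ nD) => y nDy [Ay]; have := nDy Ay.
move=> cu cB cC x Ax V nV.
have nB : \forall y \near x, (A `&` [set x | u x <= c]) y -> V (f y) :=
  key _ (@closed_le R c) cu cB x Ax V nV.
have nC : \forall y \near x, (A `&` [set x | c <= u x]) y -> V (f y) :=
  key _ (@closed_ge R c) cu cC x Ax V nV.
apply: (filterS _ (filterI nB nC)) => y [hB hC] Ay.
by case: (leP (u y) c) => h; [apply: hB|apply: hC] => //; split=> //=; exact: ltW.
Qed.

End ContOnReal.

Section ContOnProd.
Context {T : topologicalType} {I : finType} {K : topologicalType}.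

Lemma cvg_ptws (F : set_system {ptws I -> K}) (f : {ptws I -> K}) : Filter F ->
  (forall i, (fun g : {ptws I -> K} => g i) @ F --> f i) -> F --> f.
Proof.
move=> FF h; apply/cvg_sup => i; apply/cvg_image.
  rewrite eqEsubset; split => y //= _; exists (dfwith f i y) => //.
  by rewrite dfwithin.
move=> V /(h i) /= FV; exists ((fun g : {ptws I -> K} => g i) @^-1` V) => //.
rewrite eqEsubset; split => [y [g gV <-//]|y Vy].
by exists (dfwith f i y); rewrite /= ?dfwithin.
Qed.

Lemma cont_on_ptws (A : set T) (f : T -> {ptws I -> K}) :
  (forall i, cont_on A (fun x => f x i)) -> cont_on A f.
Proof. by move=> cf x Ax; apply: cvg_ptws => i; exact: cf. Qed.

Lemma ptws_continuous (i : I) : continuous (fun g : {ptws I -> K} => g i).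
Proof. exact: (@proj_continuous I (fun=> K) i). Qed.

Lemma cont_on_coord (A : set T) (f : T -> {ptws I -> K}) (i : I) :
  cont_on A f -> cont_on A (fun x => f x i).
Proof. move=> cf; apply: (@cont_on_comp_cont _ _ _ A f (fun g => g i)) => //.
exact: ptws_continuous. Qed.

End ContOnProd.

(** * Homotopies and neighbourhood deformation retracts *)

Section Clamp.
Context {R : realType}.
Implicit Types t : R.

Definition clamp t : R := Num.max 0 (Num.min 1 t).

Lemma clamp_ge0 t : 0 <= clamp t.
Proof. by rewrite /clamp le_max lexx. Qed.

Lemma clamp_le1 t : clamp t <= 1.
Proof. by rewrite /clamp ge_max ler01 ge_min lexx. Qed.

Lemma clamp_id t : 0 <= t -> t <= 1 -> clamp t = t.
Proof. by move=> t0 t1; rewrite /clamp min_r // max_r. Qed.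

Lemma clamp_le0 t : t <= 0 -> clamp t = 0.
Proof.
by move=> t0; rewrite /clamp min_r ?max_l //; apply: le_trans t0 ler01.
Qed.

Lemma clamp_ge1 t : 1 <= t -> clamp t = 1.
Proof. by move=> t1; rewrite /clamp min_l ?max_r. Qed.

Lemma cont_on_clamp (T : topologicalType) (A : set T) (f : T -> R) :
  cont_on A f -> cont_on A (fun x => clamp (f x)).
Proof.
by move=> cf; apply: cont_on_max; [|apply: cont_on_min => //]; exact: cont_on_cst.
Qed.

End Clamp.

Section Proj.
Context {T U : topologicalType}.

Lemma cont_on_fst (A : set (T * U)) : cont_on A fst.
Proof. by apply: continuous_cont_on => x; exact: cvg_fst. Qed.

Lemma cont_on_snd (A : set (T * U)) : cont_on A snd.
Proof. by apply: continuous_cont_on => x; exact: cvg_snd. Qed.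

Lemma cont_on_pairl (W : topologicalType) (A : set T) (B : set U) (f : T -> W) :
  cont_on A f -> cont_on (A `*` B) (fun p => f p.1).
Proof.
by move=> cf; apply: cont_on_comp (@cont_on_fst _) cf _ => p [].
Qed.

End Proj.

(* Time runs over all of [R], only the values at [0] and [1] being prescribed;
   precomposing with [clamp] shows that nothing is lost.  The predicate [P]
   confines the track of each point, e.g. to a subspace or to a base point. *)
Definition hmt (R : realType) (T U : topologicalType) (A : set T)
    (P : T -> U -> Prop) (f g : T -> U) :=
  exists H : T * R -> U,
    [/\ cont_on (A `*` setT) H, forall x t, A x -> P x (H (x, t)),
        forall x, A x -> H (x, 0) = f x & forall x, A x -> H (x, 1) = g x].

Section Hmt.
Context {R : realType} {T U : topologicalType}.
Implicit Types (A : set T) (P : T -> U -> Prop) (f g k : T -> U).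

Lemma hmt_unit A P f g (H : T * R -> U) : cont_on (A `*` `[0, 1] : set (T * R)) H ->
  (forall x t, A x -> 0 <= t -> t <= 1 -> P x (H (x, t))) ->
  (forall x, A x -> H (x, 0) = f x) -> (forall x, A x -> H (x, 1) = g x) ->
  hmt R A P f g.
Proof.
move=> cH PH H0 H1; exists (fun p : T * R => H (p.1, clamp p.2)); split => //=.
- apply: (cont_on_comp (f := fun p : T * R => (p.1, clamp p.2))) cH _.
    by apply: cont_on_pair; [exact: cont_on_fst|apply: cont_on_clamp; exact: cont_on_snd].
  move=> [x t] [/= Ax _]; split => //=.
  by rewrite in_itv /= clamp_ge0 clamp_le1.
- by move=> x t Ax; apply: PH => //; [exact: clamp_ge0|exact: clamp_le1].
- by move=> x Ax; rewrite clamp_le0 // H0.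
- by move=> x Ax; rewrite clamp_ge1 // H1.
Qed.

Lemma hmt_sym A P f g : hmt R A P f g -> hmt R A P g f.
Proof.
move=> [H [cH PH H0 H1]]; exists (fun p : T * R => H (p.1, 1 - p.2)); split => //=.
- apply: (cont_on_comp (f := fun p : T * R => (p.1, 1 - p.2))) cH _.
    apply: cont_on_pair; first exact: cont_on_fst.
    by apply: cont_onB; [exact: cont_on_cst|exact: cont_on_snd].
  by move=> [x t] [].
- by move=> x t; exact: PH.
- by move=> x Ax; rewrite subr0 H1.
- by move=> x Ax; rewrite subrr H0.
Qed.

Lemma hmt_trans A P g f k : hmt R A P f g -> hmt R A P g k -> hmt R A P f k.
Proof.
move=> [H [cH PH H0 H1]] [K [cK PK K0 K1]].
exists (fun p => if p.2 <= 2^-1 then H (p.1, 2 * p.2) else K (p.1, 2 * p.2 - 1)).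
have cs : cont_on (A `*` [set: R]) (fun p : T * R => 2 * p.2).
  by apply: cont_onM; [exact: cont_on_cst|exact: cont_on_snd].
split => /=.
- apply: (@cont_on_split R _ _ _ snd 2^-1); first exact: cont_on_snd.
    apply: (@cont_on_ext _ _ _ (fun p : T * R => H (p.1, 2 * p.2))).
      apply: (cont_on_comp (f := fun p : T * R => (p.1, 2 * p.2))) cH _.
        by apply: cont_on_pair; [exact: cont_on_fst|apply: cont_onW cs => p []].
      by move=> [x t] [[]].
    by move=> p [_ /= ->].
  apply: (@cont_on_ext _ _ _ (fun p : T * R => K (p.1, 2 * p.2 - 1))).
    apply: (cont_on_comp (f := fun p : T * R => (p.1, 2 * p.2 - 1))) cK _.
      apply: cont_on_pair; first exact: cont_on_fst.
      by apply: cont_onB; [apply: cont_onW cs => p []|exact: cont_on_cst].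
    by move=> [x t] [[]].
  move=> [x t] [[/= Ax _] t2]; case: ifP => // t2'.
  have -> : t = 2^-1 by apply: le_anti; rewrite t2 t2'.
  by rewrite divff ?pnatr_eq0 // subrr K0 // H1.
- by move=> x t Ax; case: ifP => _; [exact: PH|exact: PK].
- by move=> x Ax; rewrite invr_ge0 ler0n mulr0 H0.
- move=> x Ax; rewrite ifF; last by apply/negbTE; lra.
  by rewrite (_ : 2 * 1 - 1 = 1) ?K1 //; lra.
Qed.

Lemma hmtW A B P Q f g f' g' : hmt R B P f g -> A `<=` B ->
  (forall x y, A x -> P x y -> Q x y) ->
  (forall x, A x -> f x = f' x) -> (forall x, A x -> g x = g' x) ->
  hmt R A Q f' g'.
Proof.
move=> [H [cH PH H0 H1]] AB PQ ff gg; exists H; split.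
- by apply: cont_onW cH => p [/AB].
- by move=> x t Ax; apply: PQ => //; apply: PH; exact: AB.
- by move=> x Ax; rewrite H0 ?ff //; exact: AB.
- by move=> x Ax; rewrite H1 ?gg //; exact: AB.
Qed.

Lemma hmt_compl (W : topologicalType) A (B : set U) P (Q : T -> W -> Prop) f g
    (k : U -> W) : hmt R A P f g -> cont_on B k ->
  (forall x y, A x -> P x y -> B y) ->
  (forall x y, A x -> P x y -> Q x (k y)) ->
  hmt R A Q (k \o f) (k \o g).
Proof.
move=> [H [cH PH H0 H1]] ck PB PQ; exists (k \o H); split => /=.
- by apply: cont_on_comp cH ck _ => -[x t] [/= Ax _]; exact: (PB _ _ Ax (PH _ _ Ax)).
- by move=> x t Ax; apply: PQ => //; exact: PH.
- by move=> x Ax; rewrite H0.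
- by move=> x Ax; rewrite H1.
Qed.

Lemma hmt_compr (W : topologicalType) A (B : set W) P (Q : W -> U -> Prop) f g
    (k : W -> T) : hmt R A P f g -> cont_on B k ->
  (forall x, B x -> A (k x)) ->
  (forall x y, B x -> P (k x) y -> Q x y) ->
  hmt R B Q (f \o k) (g \o k).
Proof.
move=> [H [cH PH H0 H1]] ck BA PQ; exists (fun p => H (k p.1, p.2)); split => /=.
- apply: (cont_on_comp (f := fun p : W * R => (k p.1, p.2))) cH _.
    by apply: cont_on_pair; [exact: cont_on_pairl|exact: cont_on_snd].
  by move=> [x t] [/= /BA].
- by move=> x t Bx; apply: PQ => //; apply: PH; exact: BA.
- by move=> x Bx; rewrite H0 //; exact: BA.
- by move=> x Bx; rewrite H1 //; exact: BA.
Qed.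

Lemma hmt_contr A P f g :
  hmt R A P f g -> cont_on A g /\ forall x, A x -> P x (g x).
Proof.
move=> [H [cH PH _ H1]]; split; last by move=> x Ax; rewrite -H1 //; exact: PH.
apply: (@cont_on_ext _ _ _ (fun x => H (x, 1))) => //.
apply: (cont_on_comp (f := fun x : T => (x, 1 : R))) cH _ => //.
by apply: cont_on_pair; [exact: cont_on_id|exact: cont_on_cst].
Qed.

End Hmt.

(** Contractibility of a subset, with the contraction staying inside it; [contractible_ctr] derives
    it from [contractible] for the subtype. *)
Definition ctr (R : realType) (T : topologicalType) (A : set T) :=
  exists2 e, A e & hmt R A (fun _ => A) idfun (fun=> e).

(** Neighbourhood deformation retract pairs in the sense of Steenrod, slightly weakened: [u] may
    exceed 1 and may vanish outside [A], but at time 1 everything with [u < 1] has been carried into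
    [A]. *)
Record is_ndr (R : realType) (T : topologicalType) (B A : set T) (u : T -> R)
    (h : T * R -> T) : Prop := IsNdr {
  ndr_sub : A `<=` B;
  ndr_u : cont_on B u;
  ndr_h : cont_on (B `*` setT) h;
  ndr_u0 : forall x, A x -> u x = 0;
  ndr_h0 : forall x, B x -> h (x, 0) = x;
  ndr_hA : forall x t, A x -> h (x, t) = x;
  ndr_hB : forall x t, B x -> B (h (x, t));
  ndr_near : forall x, B x -> u x < 1 -> A (h (x, 1)) }.

Section Ndr.
Context {R : realType} {T U : topologicalType} {B A : set T}.
Context {u : T -> R} {h : T * R -> T}.
Hypothesis ndr : is_ndr B A u h.

Let ch1 : cont_on B (fun x => h (x, 1)).
Proof.
apply: (cont_on_comp (f := fun x : T => (x, 1 : R))) (ndr_h ndr) _ => //.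
by apply: cont_on_pair; [exact: cont_on_id|exact: cont_on_cst].
Qed.

(* The homotopy first moves [x] to [h (x, 1)], and only then follows [c]; hence
   the reparametrization. *)
Lemma ndr_extend (f : T -> U) (c : T * R -> U) : cont_on B f ->
  cont_on (A `*` setT) c -> (forall x, A x -> c (x, 0) = f x) ->
  exists H : T * R -> U, [/\ cont_on (B `*` setT) H,
    forall x, B x -> H (x, 0) = f x,
    forall x t, A x -> H (x, t) = c (x, clamp (2 * t - 1)) &
    forall x t, B x -> (exists2 y, B y & H (x, t) = f y) \/
      (exists y s, A y /\ H (x, t) = c (y, s))].
Proof.
move=> cf cc c0.
(* The time given to [c] shrinks to 0 as [u] grows to 1/2, where [K] switches to [f (h (x, 1))]; the
   two branches agree there by [c0]. The bound 1/2 is below 1, so [c] is only evaluated at points of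
   [A]. *)
pose s (p : T * R) := clamp (2 * p.2 - 1) * Num.max 0 (1 - 2 * u p.1).
pose K (p : T * R) :=
  if u p.1 <= 2^-1 then c (h (p.1, 1), s p) else f (h (p.1, 1)).
exists (fun p => if p.2 <= 2^-1 then f (h (p.1, 2 * p.2)) else K p).
have cs : cont_on (B `*` [set: R]) (fun p : T * R => 2 * p.2).
  by apply: cont_onM; [exact: cont_on_cst|exact: cont_on_snd].
have cu : cont_on (B `*` [set: R]) (fun p => u p.1).
  exact/cont_on_pairl/(ndr_u ndr).
have cfh : cont_on (B `*` [set: R]) (fun p : T * R => f (h (p.1, 1))).
  apply: (cont_on_pairl (f := fun x => f (h (x, 1)))); apply: cont_on_comp ch1 cf _ => x.
  exact: (ndr_hB ndr).
have nearA x : B x -> u x <= 2^-1 -> A (h (x, 1)).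
  by move=> Bx ux; apply: (ndr_near ndr) => //; apply: (le_lt_trans ux); lra.
split => /=.
- apply: (@cont_on_split R _ _ _ snd 2^-1); first exact: cont_on_snd.
    apply: (@cont_on_ext _ _ _ (fun p : T * R => f (h (p.1, 2 * p.2)))); last first.
      by move=> p [_ /= ->].
    apply: (@cont_on_comp _ _ _ _ B (fun p : T * R => h (p.1, 2 * p.2))) cf _.
      apply: (cont_on_comp (f := fun p : T * R => (p.1, 2 * p.2))) (ndr_h ndr) _.
        by apply: cont_on_pair; [exact: cont_on_fst|apply: cont_onW cs => p []].
      by move=> [x t] [[]].
    by move=> [x t] [[/= Bx _] _]; exact: (ndr_hB ndr).
  apply: (@cont_on_ext _ _ _ K); last first.
    move=> [x t] [[/= Bx _] t2]; case: ifP => // t2'.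
    have -> : t = 2^-1 by apply: le_anti; rewrite t2 t2'.
    rewrite /K /s /= divff ?pnatr_eq0 // subrr clamp_le0 // mul0r.
    by case: ifP => // ux; rewrite c0 //; exact: nearA.
  have sub2 : B `*` [set: R] `&` [set x | 2^-1 <= x.2] `<=` B `*` [set: R].
    by move=> p [].
  apply: (cont_onW sub2) => {sub2}.
  apply: (@cont_on_split R _ _ _ (fun p : T * R => u p.1) 2^-1) => //.
    apply: (@cont_on_ext _ _ _ (fun p : T * R => c (h (p.1, 1), s p))); last first.
      by move=> p [_ /= ux]; rewrite /K ux.
    apply: (cont_on_comp (f := fun p : T * R => (h (p.1, 1), s p))) cc _.
      have sub1 : B `*` [set: R] `&` [set x | u x.1 <= 2^-1] `<=` B `*` [set: R].
        by move=> p [].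
      apply: (cont_onW sub1); apply: cont_on_pair; first exact: (cont_on_pairl ch1).
      apply: cont_onM.
        by apply: cont_on_clamp; apply: cont_onB => //; exact: cont_on_cst.
      apply: cont_on_max; first exact: cont_on_cst.
      by apply: cont_onB; [exact: cont_on_cst|apply: cont_onM => //; exact: cont_on_cst].
    by move=> [x t] [[/= Bx _] ux]; split => //; exact: nearA.
  apply: (@cont_on_ext _ _ _ (fun p : T * R => f (h (p.1, 1)))).
    by apply: cont_onW cfh => p [].
  move=> [x t] [[/= Bx _] ux]; rewrite /K /=; case: ifP => // ux'.
  have {ux}e : u x = 2^-1 by apply: le_anti; rewrite ux ux'.
  rewrite /s /= e divff ?pnatr_eq0 // subrr maxxx mulr0 c0 //.
  exact: nearA.
- by move=> x Bx; rewrite invr_ge0 ler0n mulr0 (ndr_h0 ndr).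
- move=> x t Ax; rewrite /K /s /= !(ndr_hA ndr) // (ndr_u0 ndr) //.
  rewrite invr_ge0 ler0n mulr0 subr0 max_r // mulr1.
  by case: ifP => // t2; rewrite clamp_le0 ?c0 //; lra.
- move=> x t Bx; case: ifP => _; last rewrite /K /=; last case: ifP => ux.
  + by left; exists (h (x, 2 * t)) => //; exact: (ndr_hB ndr).
  + by right; exists (h (x, 1)), (s (x, t)); split => //; exact: nearA.
  + by left; exists (h (x, 1)) => //; exact: (ndr_hB ndr).
Qed.

(* Contracting [Y] joins [f] to [g] through the base point; damping the
   contraction by [u], which vanishes on [A], keeps [A] fixed. *)
Lemma ndr_homotopic (Y : set U) (f g : T -> U) : ctr R Y ->
  cont_on B f -> cont_on B g -> (forall x, B x -> Y (f x)) ->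
  (forall x, B x -> Y (g x)) -> (forall x, A x -> f x = g x) ->
  hmt R B (fun x y => Y y /\ (A x -> y = f x)) f g.
Proof.
move=> [e Ye [C [cC YC C0 C1]]] cf cg Yf Yg fg.
(* Replacing a map by its composite with [h (_, 1)] is a homotopy fixed on [A]; afterwards [f] and
   [g] already agree wherever [u < 1]. *)
have toh k : cont_on B k -> (forall x, B x -> Y (k x)) -> (forall x, A x -> k x = f x) ->
    hmt R B (fun x y => Y y /\ (A x -> y = f x)) k (fun x => k (h (x, 1))).
  move=> ck Yk kf; exists (fun p : T * R => k (h p)); split.
  - by apply: cont_on_comp (ndr_h ndr) ck _ => -[x t] [/= Bx _]; exact: (ndr_hB ndr).
  - move=> x t Bx; split; first exact/Yk/(ndr_hB ndr).
    by move=> Ax; rewrite (ndr_hA ndr) ?kf.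
  - by move=> x Bx; rewrite (ndr_h0 ndr).
  - by [].
apply: (@hmt_trans _ _ _ _ _ (fun x => f (h (x, 1)))); first exact: toh.
apply: (@hmt_trans _ _ _ _ _ (fun x => g (h (x, 1)))); last first.
  by apply: hmt_sym; apply: toh => // x /fg.
(* A tent in time: [C] is followed out and back, up to [clamp (u x)]. At half time the branches
   meet: if [u x < 1] then [h (x, 1)] is in [A], where [f] and [g] agree, and otherwise both have
   reached the base point of [Y]. *)
pose s (p : T * R) := (1 - `|2 * p.2 - 1|) * clamp (u p.1).
exists (fun p => if p.2 <= 2^-1 then C (f (h (p.1, 1)), s p)
                 else C (g (h (p.1, 1)), s p)).
have cs : cont_on (B `*` [set: R]) s.
  apply: cont_onM.
    apply: cont_onB; first exact: cont_on_cst.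
    apply: cont_on_norm; apply: cont_onB; last exact: cont_on_cst.
    by apply: cont_onM; [exact: cont_on_cst|exact: cont_on_snd].
  by apply: cont_on_clamp; exact/cont_on_pairl/(ndr_u ndr).
have cq (k : T -> U) : cont_on B k -> (forall x, B x -> Y (k x)) ->
    cont_on (B `*` [set: R]) (fun p : T * R => C (k (h (p.1, 1)), s p)).
  move=> ck Yk.
  apply: (cont_on_comp (f := fun p : T * R => (k (h (p.1, 1)), s p))) cC _.
    apply: cont_on_pair => //; apply: (cont_on_pairl (f := fun x => k (h (x, 1)))).
    by apply: cont_on_comp ch1 ck _ => x; exact: (ndr_hB ndr).
  by move=> [x t] [/= Bx _]; split => //; exact/Yk/(ndr_hB ndr).
split => /=.
- apply: (@cont_on_split R _ _ _ snd 2^-1); first exact: cont_on_snd.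
    apply: (@cont_on_ext _ _ _ (fun p : T * R => C (f (h (p.1, 1)), s p))).
      by apply: cont_onW (cq f cf Yf) => p [].
    by move=> p [_ /= ->].
  apply: (@cont_on_ext _ _ _ (fun p : T * R => C (g (h (p.1, 1)), s p))).
    by apply: cont_onW (cq g cg Yg) => p [].
  move=> [x t] [[/= Bx _] t2]; case: ifP => // t2'.
  have -> : t = 2^-1 by apply: le_anti; rewrite t2 t2'.
  rewrite /s /= divff ?pnatr_eq0 // subrr normr0 subr0 mul1r.
  have [ux|ux] := ltP (u x) 1; first by rewrite fg //; exact: (ndr_near ndr).
  by rewrite clamp_ge1 // !C1 //; [apply/Yf/(ndr_hB ndr)|apply/Yg/(ndr_hB ndr)].
- move=> x t Bx; split.
    by case: ifP => _; apply: YC; [apply/Yf/(ndr_hB ndr)|apply/Yg/(ndr_hB ndr)].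
  move=> Ax; rewrite /s /= (ndr_hA ndr) // (ndr_u0 ndr) // clamp_le0 // mulr0.
  have Bx0 := ndr_sub ndr Ax; by case: ifP => _; rewrite C0 ?fg // -?fg //; exact: Yf.
- move=> x Bx; rewrite invr_ge0 ler0n /s /= mulr0 sub0r normrN normr1 subrr mul0r.
  by rewrite C0 //; exact/Yf/(ndr_hB ndr).
- move=> x Bx; rewrite ifF; last by apply/negbTE; lra.
  rewrite /s /= (_ : 2 * 1 - 1 = 1 :> R); last by lra.
  by rewrite normr1 subrr mul0r C0 //; exact/Yg/(ndr_hB ndr).
Qed.

End Ndr.

(** * Retracts from threshold maps *)

Section Dist.
Context {R : realType} {V : finType}.
Local Notation E := {ptws V -> R}.
Implicit Types (x y z : E) (A B : set E).

Definition dist x y : R := \sum_v `|x v - y v|.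

Lemma dist_ge0 x y : 0 <= dist x y.
Proof. by apply: sumr_ge0. Qed.

Lemma distxx x : dist x x = 0.
Proof. by rewrite /dist big1 // => v _; rewrite subrr normr0. Qed.

Lemma dist_sym x y : dist x y = dist y x.
Proof. by apply: eq_bigr => v _; rewrite distrC. Qed.

Lemma dist_triangle y x z : dist x z <= dist x y + dist y z.
Proof. by rewrite /dist -big_split ler_sum // => v _; exact: ler_distD. Qed.

Lemma le_dist x y v : `|x v - y v| <= dist x y.
Proof. by rewrite /dist (bigD1 v) //= lerDl sumr_ge0. Qed.

Lemma dist_continuous x : continuous (dist x : E -> R).
Proof.
apply/cont_onT; apply: cont_on_sum => v _; apply: cont_on_norm.
apply: cont_onB; first exact: cont_on_cst.
exact/continuous_cont_on/ptws_continuous.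
Qed.

Lemma near_dist x e : 0 < e -> \forall y \near x, dist x y < e.
Proof.
move=> e0; have : (dist x : E -> R) @ x --> (dist x x : R) := @dist_continuous x x.
by rewrite distxx => /cvgr_lt; exact.
Qed.

Definition setdist A x : R := inf [set dist x y | y in A].

Lemma setdist_le A x y : A y -> setdist A x <= dist x y.
Proof.
move=> Ay; apply: ge_inf; last by exists y.
by exists 0 => _ [z _ <-]; exact: dist_ge0.
Qed.

Lemma setdist_ge0 A x : 0 <= setdist A x.
Proof.
rewrite /setdist; have [->|/set0P[y Ay]] := eqVneq A set0.
  by rewrite image_set0 inf0.
by apply: lb_le_inf; [exists (dist x y), y|move=> _ [z _ <-]; exact: dist_ge0].
Qed.

Lemma setdist_lt A x e : A !=set0 -> setdist A x < e -> exists2 y, A y & dist x y < e.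
Proof.
move=> [y Ay] h; have [|_ [z Az <-] ?] := inf_lt _ h; last by exists z.
by exists (dist x y), y.
Qed.

Lemma setdist_eq0 A x : A x -> setdist A x = 0.
Proof.
move=> Ax; apply: le_anti; rewrite setdist_ge0 andbT.
by rewrite -(distxx x); exact: setdist_le.
Qed.

Lemma setdist_lip A x y : A !=set0 -> setdist A x <= dist x y + setdist A y.
Proof.
move=> A0; rewrite -lerBlDl; apply: lb_le_inf.
  by case: A0 => z Az; exists (dist y z), z.
move=> _ [z Az <-]; rewrite lerBlDl.
exact: le_trans (setdist_le _ Az) (dist_triangle _ _ _).
Qed.

Lemma setdist_continuous A : A !=set0 -> continuous (setdist A : E -> R).
Proof.
move=> A0 x; apply/(@cvgrPdist_lt R R E (nbhs x) _ (setdist A) (setdist A x)) => e e0.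
apply: filterS (near_dist x e0) => y xy.
apply: le_lt_trans xy; rewrite ler_distl.
have := setdist_lip x y A0; have := setdist_lip y x A0.
by rewrite (dist_sym y x); lra.
Qed.

(* The homotopy pushes [x] by a threshold proportional to its distance to [A]:
   points of [A] are not moved, nearby points are pushed into [A]. *)
Lemma threshold_ndr A B (rho : E * R -> E) (d0 : R) : 0 < d0 ->
  A !=set0 -> A `<=` B ->
  cont_on (B `*` `[0, d0] : set (E * R)) rho ->
  (forall x, B x -> rho (x, 0) = x) ->
  (forall x t, B x -> 0 <= t -> t <= d0 -> B (rho (x, t))) ->
  (forall x y t, B x -> A y -> 0 <= t -> t <= d0 -> dist x y <= t -> A (rho (x, t))) ->
  (forall x, B x -> (forall e, 0 < e -> exists2 y, A y & dist x y < e) -> A x) ->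
  exists u h, @is_ndr R E B A u h.
Proof.
move=> d00 A0 AB crho rho0 rhoB rhoA clA.
(* Twice the distance, because the infimum need not be attained: some point of [A] is then within
   the threshold. The function [u] below is scaled so that [u < 1] means that the cap [d0] is not
   active. *)
pose w x := Num.min (2 * setdist A x) d0.
have w0 x : 0 <= w x by rewrite le_min (ltW d00) andbT mulr_ge0 ?setdist_ge0.
have wd x : w x <= d0 by rewrite ge_min lexx orbT.
have csd : cont_on B (setdist A : E -> R).
  exact/continuous_cont_on/setdist_continuous.
have cw : cont_on B (w : E -> R).
  by apply: cont_on_min; [apply: cont_onM => //|]; exact: cont_on_cst.
have tw x t : 0 <= clamp t * w x <= d0.
  rewrite mulr_ge0 ?clamp_ge0 //=; apply: le_trans (wd x).
  by rewrite ler_piMl ?clamp_le1.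
exists (fun x => 2 * setdist A x / d0), (fun p => rho (p.1, clamp p.2 * w p.1)).
split => //=.
- apply: cont_onM; last exact: cont_on_cst.
  by apply: cont_onM => //; exact: cont_on_cst.
- apply: (cont_on_comp (f := fun p : E * R => (p.1, clamp p.2 * w p.1))) crho _.
    apply: cont_on_pair; first exact: cont_on_fst.
    apply: cont_onM; first by apply: cont_on_clamp; exact: cont_on_snd.
    exact: (cont_on_pairl cw).
  by move=> [x t] [/= Bx _]; split => //=; rewrite in_itv /= tw.
- by move=> x Ax; rewrite setdist_eq0 // mulr0 mul0r.
- by move=> x Bx; rewrite clamp_le0 // mul0r rho0.
- move=> x t Ax; rewrite /w setdist_eq0 // mulr0 min_l ?mulr0 ?rho0 //; last exact: ltW.
  exact: AB.
- by move=> x t Bx; have /andP[] := tw x t; exact: rhoB.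
- move=> x Bx; rewrite ltr_pdivrMr // mul1r => xd.
  rewrite clamp_ge1 // mul1r /w min_l; last exact: ltW.
  have := setdist_ge0 A x; rewrite le_eqVlt => /predU1P[e|pos].
    rewrite -e mulr0 rho0 //; apply: clA => // eps eps0.
    by apply: setdist_lt => //; rewrite -e.
  have [//||y Ay xy] := @setdist_lt A x (2 * setdist A x); first by lra.
  by apply: (@rhoA _ y) => //; lra.
Qed.

End Dist.

Lemma finite_pos_lb (R : realType) (I : finType) (P : pred I) (f : I -> R) :
  (forall i, P i -> 0 < f i) -> exists2 e : R, 0 < e & forall i, P i -> e <= f i.
Proof.
move=> f0; suff [e e0 he] : exists2 e : R, 0 < e & forall i, i \in enum I -> P i -> e <= f i.
  by exists e => // i; apply: he; rewrite mem_enum.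
elim: (enum I) => [|j s [e e0 IH]]; first by exists 1.
have [Pj|nPj] := boolP (P j); last first.
  exists e => // i; rewrite in_cons => /predU1P[->|/IH//].
  by rewrite (negPf nPj).
exists (Num.min e (f j)); first by rewrite lt_min e0 f0.
move=> i; rewrite in_cons ge_min => /predU1P[->|/IH h /h ->//].
by rewrite lexx orbT.
Qed.

(** * Simplicial pairs as neighbourhood deformation retracts *)

Section Geometric.
Context {R : realType} {V : finType}.
Local Notation E := {ptws V -> R}.
Implicit Types (F G : {set {set V}}) (x y : E).

Definition supp x : {set V} := finset (fun v => x v != 0).

(** The formula of [realization] for a bare family of sets; it will be applied to the union of the
    face sets of the [S i]. *)
Definition geom F : set E :=
  [set x | [/\ forall v, 0 <= x v, \sum_v x v = 1 & supp x \in F]].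

Definition down_closed F := forall s t : {set V},
  s \in F -> t \subset s -> t != finset.set0 -> t \in F.

Lemma supp_neq0 x : \sum_v x v = 1 -> supp x != finset.set0.
Proof.
move=> x1; apply/eqP => s0; have : 1 = 0 :> R; last by move/eqP; rewrite oner_eq0.
rewrite -x1 big1 // => v _; apply/eqP/negbNE; apply/negP => xv.
have : v \in supp x by rewrite inE.
by rewrite s0 inE.
Qed.

Lemma geom_sub F G x : down_closed F -> geom G x ->
  (exists2 y, geom F y & supp x \subset supp y) -> geom F x.
Proof.
move=> dF [x0 x1 _] [y [_ _ Fy] xy]; split => //.
by apply: dF Fy xy _; exact: supp_neq0.
Qed.

(** Lowering all barycentric coordinates by [t], cutting at 0 and renormalizing. Coordinates at most
    [t] disappear, so a point within [t] of [y] is sent to a face of the carrier of [y]. At most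
    [#|V| * d0 < 1/2] of the total mass 1 is lost, so renormalizing is possible. *)
Let cut x (t : R) v := Num.max (x v - t) 0.
Let trunc (p : E * R) : E := fun v => cut p.1 p.2 v / \sum_w cut p.1 p.2 w.
Let d0 : R := (2 * #|V|.+1%:R)^-1.

Let cut_sum x t : \sum_v x v = 1 -> 0 <= t -> t <= d0 -> 0 < \sum_w cut x t w.
Proof.
move=> x1 t0 td; have : 1 - \sum_(v : V) t <= \sum_w cut x t w.
  rewrite -x1 -sumrB; apply: ler_sum => v _.
  by rewrite /cut le_max lexx.
apply: lt_le_trans; rewrite sumr_const -mulr_natl subr_gt0.
have : #|V|%:R * t <= #|V|%:R * d0 by rewrite ler_wpM2l.
move=> /le_lt_trans; apply; rewrite /d0 ltr_pdivrMr ?mul1r ?mulr_gt0 //.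
by rewrite -addn1 natrD; have := ler0n R #|V|; lra.
Qed.

Lemma geom_ndr F G : down_closed F -> down_closed G -> F \subset G ->
  geom F !=set0 -> exists u h, @is_ndr R E (geom G) (geom F) u h.
Proof.
move=> dF dG FG F0.
have d00 : 0 < d0 by rewrite invr_gt0 mulr_gt0.
have trunc_ok x t H (dH : down_closed H) : geom G x -> 0 <= t -> t <= d0 ->
    (exists2 y, geom H y & forall v, y v = 0 -> x v <= t) -> geom H (trunc (x, t)).
  move=> [x0 x1 _] t0 td [y Hy yx].
  have S0 := cut_sum x1 t0 td; have S0' := lt0r_neq0 S0.
  have t1 : \sum_v trunc (x, t) v = 1 by rewrite /trunc -mulr_suml divff.
  have tg : geom [set: {set V}] (trunc (x, t)).
    split; rewrite ?inE // => v; rewrite /trunc /= divr_ge0 ?(ltW S0) //.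
    by rewrite /cut le_max lexx orbT.
  apply: (geom_sub dH tg); exists y => //.
  apply/fintype.subsetP => v; rewrite !inE; apply: contra => /eqP /yx xt.
  by rewrite /trunc /cut /= max_r ?mul0r // subr_le0.
apply: (@threshold_ndr R V _ _ trunc d0) => //.
- by move=> x [x0 x1 Fx]; split => //; exact: (fintype.subsetP FG).
- apply: cont_on_ptws => v; have cc w :
      cont_on (geom G `*` `[0, d0] : set (E * R)) (fun p : E * R => cut p.1 p.2 w).
    apply: cont_on_max; last exact: cont_on_cst.
    apply: cont_onB; last exact: cont_on_snd.
    by apply: (@cont_on_coord _ _ _ _ (fst : E * R -> E)); exact: cont_on_fst.
  apply: cont_onM; first exact: cc.
  apply: cont_onV; first by apply: cont_on_sum => w _; exact: cc.
  move=> [x t] [/= [_ x1 _]]; rewrite in_itv /= => /andP[t0 td].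
  by apply: lt0r_neq0; exact: cut_sum.
- move=> x [x0 x1 _]; have e v : cut x 0 v = x v by rewrite /cut subr0 max_l.
  apply/funext => v; rewrite /trunc /= e (eq_bigr x) ?x1 ?divr1 //.
- move=> x t Gx t0 td; apply: (trunc_ok x t _ dG) => //; exists x => // v ->.
  exact: t0.
- move=> x y t Gx Fy t0 td xy; apply: (trunc_ok x t _ dF) => //; exists y => // v yv.
  by have := le_trans (le_dist x y v) xy; rewrite yv subr0; apply: le_trans; exact: ler_norm.
(* If [y] is closer to [x] than the least nonzero coordinate of [x], no such coordinate vanishes at
   [y], and [x] lies in a face of the carrier of [y]. *)
- move=> x [x0 x1 Gx] near; have [|e e0 he] := @finite_pos_lb R V (fun v => x v != 0) x.
    by move=> v xv; rewrite lt_def xv x0.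
  have [y Fy xy] := near e e0; apply: (@geom_sub F G) => //; exists y => //.
  apply/fintype.subsetP => v; rewrite !inE => /[dup] xv0 /he ex.
  apply: contraTneq (le_lt_trans (le_dist x y v) xy) => yv.
  by rewrite yv subr0 -leNgt; apply: le_trans ex _; exact: ler_norm.
Qed.

End Geometric.

(** * Cubical pairs as neighbourhood deformation retracts *)

Section Cubical.
Context {R : realType} {V : finType} (L : nat).
Local Notation E := {ptws V -> R}.
Implicit Types (x y : E) (A B : set E).

(* [y] lies in the smallest closed cell containing [x], for the product cell
   structure with vertices [0, ..., L] on each axis. *)
Definition face x y := forall v z, (z <= L)%N ->
  (x v <= z%:R -> y v <= z%:R) /\ (z%:R <= x v -> z%:R <= y v).

(** The half-lines below [0] and above [L] count as closed cells of an axis, so such a set need not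
    be bounded; [box] imposes this later. *)
Definition cubical A := forall x y, A x -> face x y -> A y.

(** The piecewise linear map that flattens [[z - t, z + t]] to [z] for each integer [z] from [0] to
    [L] and stretches the unit intervals in between. Each unit interval and each of the two
    half-lines contributes one summand, which varies only there. Taking [t] at most 1/4 keeps
    [1 - 2 * t] positive. *)
Definition snap (t x : R) : R := Num.min (x + t) 0 +
  \sum_(j < L) clamp ((x - j%:R - t) / (1 - 2 * t)) + Num.max (x - L%:R - t) 0.

Lemma sum_ltn z n : (z <= n)%N -> \sum_(j < n) ((j < z)%N : nat)%:R = z%:R :> R.
Proof.
elim: n => [|n IH]; first by rewrite leqn0 => /eqP ->; rewrite big_ord0.
rewrite leq_eqVlt big_ord_recr /= => /predU1P[->|zn].
  rewrite ltnSn (eq_bigr (fun=> 1)) => [|j _]; last by rewrite ltnS ltnW.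
  by rewrite sumr_const card_ord -natrD addn1.
by rewrite IH // ltnNge (zn : (z <= n)%N) addr0.
Qed.

Lemma snap_le (t x : R) z : (z <= L)%N -> 0 <= t -> t <= 4^-1 -> x <= z%:R + t ->
  snap t x <= z%:R.
Proof.
move=> zL t0 t4 xz; have zL' : z%:R <= L%:R :> R by rewrite ler_nat.
rewrite /snap (@max_r _ _ (x - L%:R - t)); last by lra.
rewrite addr0 -[leRHS]add0r lerD ?ge_min ?lexx ?orbT //.
rewrite -(sum_ltn zL); apply: ler_sum => j _; case: ltnP => jz.
  exact: clamp_le1.
rewrite clamp_le0 // pmulr_lle0 ?invr_gt0; last by lra.
have : z%:R <= j%:R :> R by rewrite ler_nat.
by lra.
Qed.

Lemma snap_ge (t x : R) z : (z <= L)%N -> 0 <= t -> t <= 4^-1 -> z%:R - t <= x ->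
  z%:R <= snap t x.
Proof.
move=> zL t0 t4 xz; have z0 : 0 <= z%:R :> R by rewrite ler0n.
rewrite /snap min_r; last by lra.
rewrite add0r -[leLHS]addr0 lerD ?le_max ?lexx ?orbT //.
rewrite -(sum_ltn zL); apply: ler_sum => j _; case: ltnP => jz; last exact: clamp_ge0.
rewrite clamp_ge1 // ler_pdivlMr; last by lra.
have : j%:R + 1 <= z%:R :> R by rewrite natr1 ler_nat.
by lra.
Qed.

Lemma snap0 (x : R) : snap 0 x = x.
Proof.
rewrite /snap addr0 mulr0 !subr0.
have : Num.min x 0 + Num.max (x - 0%:R) 0 = x by rewrite subr0; case: leP => h; lra.
move=> h; rewrite -[RHS]h -addrA; congr (_ + _) => {h}.
elim: L => [|n IH]; first by rewrite big_ord0 add0r subr0.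
rewrite big_ord_recr /= -IH -addrA; congr (_ + _).
rewrite ?subr0 divr1 -natr1; have [xn|nx] := lerP x n%:R.
  by rewrite clamp_le0 ?subr_le0 // !max_r; lra.
have [xn|nx'] := lerP x (n%:R + 1).
  by rewrite clamp_id ?(@max_r _ _ (x - (n%:R + 1))) ?max_l; lra.
by rewrite clamp_ge1 ?max_l ?(@max_l _ _ (x - n%:R)); lra.
Qed.

Let snapv (p : E * R) : E := fun v => snap p.2 (p.1 v).

Let face_snap x y t : 0 <= t -> t <= 4^-1 -> dist x y <= t -> face y (snapv (x, t)).
Proof.
move=> t0 t4 xy v z zL; have := le_trans (le_dist x y v) xy.
rewrite ler_distl => /andP[h1 h2].
by split => yz; rewrite /snapv /=; [apply: snap_le|apply: snap_ge] => //; lra.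
Qed.

Lemma cubical_near A x : cubical A ->
  (forall e, 0 < e -> exists2 y, A y & dist x y < e) -> A x.
Proof.
(* [e] is a lower bound for the nonzero distances from coordinates of [x] to integers up to [L]: a
   point [y] closer than that is on no wrong side of an integer, so [x] is in its closed cell. *)
move=> cA near; have [|e e0 he] := @finite_pos_lb R (V * 'I_L.+1)%type
  (fun p => x p.1 != p.2%:R) (fun p => `|x p.1 - p.2%:R|).
  by move=> p xp; rewrite normr_gt0 subr_eq0.
have [y Ay xy] := near e e0; apply: cA Ay _ => v z zL.
have {}he := he (v, Ordinal (zL : (z < L.+1)%N)).
have := le_lt_trans (le_dist x y v) xy; rewrite ltr_distl => /andP[h1 h2].
split => yz; rewrite leNgt; apply/negP => xz; have := he; rewrite /=.
- rewrite gt_eqF // gtr0_norm ?subr_gt0 // => /(_ isT); lra.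
- rewrite lt_eqF // ltr0_norm ?subr_lt0 // => /(_ isT); lra.
Qed.

Lemma cubical_closed A : cubical A -> closed A.
Proof.
move=> cA x clx; apply: (cubical_near cA) => e e0.
by have [y [Ay xy]] := clx _ (near_dist x e0); exists y.
Qed.

Lemma cubical_ndr A B : cubical A -> cubical B -> A `<=` B -> A !=set0 ->
  exists u h, @is_ndr R E B A u h.
Proof.
move=> cA cB AB A0; apply: (@threshold_ndr R V _ _ snapv 4^-1) => //.
- apply: cont_on_ptws => v.
  have cx : cont_on (B `*` `[0, 4^-1] : set (E * R)) (fun p : E * R => p.1 v).
    by apply: (@cont_on_coord _ _ _ _ (fst : E * R -> E)); exact: cont_on_fst.
  have ct : cont_on (B `*` `[0, 4^-1] : set (E * R)) (snd : E * R -> R).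
    exact: cont_on_snd.
  apply: cont_onD; last first.
    apply: cont_on_max; last exact: cont_on_cst.
    by apply: cont_onB => //; apply: cont_onB => //; exact: cont_on_cst.
  apply: cont_onD.
    by apply: cont_on_min; [exact: cont_onD|exact: cont_on_cst].
  apply: cont_on_sum => j _; apply: cont_on_clamp; apply: cont_onM.
    by apply: cont_onB => //; apply: cont_onB => //; exact: cont_on_cst.
  apply: cont_onV.
    apply: cont_onB; first exact: cont_on_cst.
    by apply: cont_onM => //; exact: cont_on_cst.
  move=> [x t] [/= _]; rewrite in_itv /= => /andP[t0 t4].
  by apply: lt0r_neq0; lra.
- by move=> x _; apply/funext => v; rewrite /snapv /= snap0.
- move=> x t Bx t0 t4; apply: cB (Bx) _; apply: face_snap => //.
  by rewrite distxx.
- by move=> x y t Bx Ay t0 t4 xy; apply: cA (Ay) _; exact: face_snap.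
- by move=> x Bx; exact: cubical_near.
Qed.

End Cubical.

(** * Collapsing contractible subspaces *)

Lemma glue_family (I : Type) (T U : topologicalType) (i0 : I) (A_ : I -> set T)
    (f_ : I -> T -> U) :
  (forall i x, A_ i x -> \forall y \near x, forall j, A_ j y -> j = i) ->
  (forall i, cont_on (A_ i) (f_ i)) ->
  exists2 f : T -> U, cont_on (\bigcup_i A_ i) f &
    forall i x, A_ i x -> f x = f_ i x.
Proof.
move=> iso cf; have idx x : exists i, forall j, A_ j x -> j = i.
  have [[i Aix]|nA] := pselect (exists i, A_ i x).
    by exists i; exact: nbhs_singleton (iso i x Aix).
  by exists i0 => j Ajx; case: nA; exists j.
have [k hk] := choice idx; pose f x := f_ (k x) x.
have fE i x : A_ i x -> f x = f_ i x by move=> Aix; rewrite /f -(hk x i Aix).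
exists f => // x [i _ Aix]; rewrite (fE i x Aix) => V nV.
have h1 : \forall y \near x, A_ i y -> V (f_ i y) := cf i x Aix V nV.
apply: (filterS _ (filterI h1 (iso i x Aix))) => y [hV hj] [j _ Ajy].
by rewrite /= (fE j y Ajy); have e := hj j Ajy; rewrite -e in hV; exact: hV.
Qed.

Section TupleEquiv.
Context {R : realType} {T : topologicalType}.
Implicit Types (B : set T).

Lemma path_through B (e : nat -> T) (m : nat) : ctr R B -> (forall i, B (e i)) ->
  exists G : R -> T, [/\ continuous G, forall t, B (G t) &
    forall i, (i < m)%N -> G i%:R = e i].
Proof.
move=> [b Bb [C [cC BC C0 C1]]] Be.
(* The induction needs [G] to rest at [b] from [m - 1/2] on; the next step inserts an excursion from
   [b] to [e m] and back, centred at time [m]. *)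
suff [G [cG BG Gi _]] : exists G : R -> T, [/\ continuous G, forall t, B (G t),
    forall i, (i < m)%N -> G i%:R = e i & forall t, m%:R - 2^-1 <= t -> G t = b].
  by exists G.
elim: m => [|m [G [cG BG Gi Gb]]]; first by exists (fun=> b); split=> // x; exact: cvg_cst.
exists (fun t => if t <= m%:R - 2^-1 then G t else C (e m, clamp (2 * `|t - m%:R|))).
split.
- apply/cont_onT; apply: (@cont_on_split R _ _ _ idfun (m%:R - 2^-1)).
  + exact: cont_on_id.
  + apply: (@cont_on_ext _ _ _ G); first exact: continuous_cont_on.
    by move=> t [_ /= ->].
  apply: (@cont_on_ext _ _ _ (fun t : R => C (e m, clamp (2 * `|t - m%:R|)))).
    apply: (cont_on_comp (f := fun t : R => (e m, clamp (2 * `|t - m%:R|)))) cC _.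
      apply: cont_on_pair; first exact: cont_on_cst.
      apply: cont_on_clamp; apply: cont_onM; first exact: cont_on_cst.
      by apply: cont_on_norm; apply: cont_onB; [exact: cont_on_id|exact: cont_on_cst].
    by move=> t _; split => //=.
  move=> t [_ /= ht]; case: ifP => // ht'; rewrite Gb // clamp_ge1 ?C1 //.
  by rewrite ler0_norm; lra.
- by move=> t; case: ifP => _; [exact: BG|exact: BC].
- move=> i; rewrite ltnS leq_eqVlt => /predU1P[->|im].
    by rewrite ifF ?subrr ?normr0 ?mulr0 ?clamp_le0 ?C0 //; apply/negbTE; lra.
  have im' : i%:R + 1 <= m%:R :> R by rewrite natr1 ler_nat.
  by rewrite ifT ?Gi //; lra.
- move=> t; rewrite -natr1 => ht; rewrite ifF; last by apply/negbTE; lra.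
  by rewrite clamp_ge1 ?C1 // ger0_norm; lra.
Qed.

(** The [A_ i] are separated from each other, so their contractions glue to a homotopy on the union,
    which [ndr_extend] spreads over [B]. An [A_ i] may be empty; its point is then the default
    [t0]. *)
Lemma ndr_collapse (I : Type) (i0 : I) (t0 : T) B (A_ : I -> set T) (u : T -> R) h :
  is_ndr B (\bigcup_i A_ i) u h ->
  (forall i x, A_ i x -> \forall y \near x, forall j, A_ j y -> B y -> j = i) ->
  (forall i, A_ i !=set0 -> ctr R (A_ i)) ->
  exists (g : T -> T) (e : I -> T),
    hmt R B (fun x y => B y /\ forall i, A_ i x -> A_ i y) idfun g /\
    forall i x, A_ i x -> g x = e i /\ A_ i (e i).
Proof.
move=> ndr iso ctrA.
have AB i x : A_ i x -> B x by move=> Aix; apply: (ndr_sub ndr); exists i.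
have /choice[ec hec] : forall i, exists ec : T * (T * R -> T), A_ i !=set0 ->
    A_ i ec.1 /\ [/\ cont_on (A_ i `*` setT) ec.2,
    forall x t, A_ i x -> A_ i (ec.2 (x, t)), forall x, A_ i x -> ec.2 (x, 0) = x &
    forall x, A_ i x -> ec.2 (x, 1) = ec.1].
  move=> i; have [/ctrA[e Ae [c hc]]|n0] := pselect (A_ i !=set0); first by exists (e, c).
  by exists (t0, fun=> t0).
pose e i := (ec i).1; pose c i := (ec i).2.
have hc i x : A_ i x -> A_ i (e i) /\ [/\ cont_on (A_ i `*` setT) (c i),
    forall x t, A_ i x -> A_ i (c i (x, t)), forall x, A_ i x -> c i (x, 0) = x &
    forall x, A_ i x -> c i (x, 1) = e i].
  by move=> Aix; apply: hec; exists x.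
have [||cc ccc ccE] := @glue_family _ (T * R)%type T i0 (fun i => A_ i `*` setT) c.
- move=> i [x t] [/= Aix _].
  have near : \forall p \near (x, t), forall j, A_ j p.1 -> B p.1 -> j = i.
    exact: (@cvg_fst T R (nbhs x) (nbhs t) _ _ (iso i x Aix)).
  apply: (filterS _ near).
  by move=> [y s] /= hy j [/= Ajy _]; exact: (hy j Ajy (AB _ _ Ajy)).
- by move=> i [x t] [/= Aix _]; have [_ [h' _ _ _]] := hc i x Aix; exact: h'.
have [|||Phi [cPhi Phi0 PhiA PhiB]] := @ndr_extend R T T B _ u h ndr idfun cc.
- exact: cont_on_id.
- by apply: cont_onW ccc => -[x t] [/= [i _ Aix] _]; exists i.
- by move=> x [i _ Aix]; rewrite (ccE i (x, 0)) //; have [_ [_ _ -> //]] := hc i x Aix.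
have PhiAi i x t : A_ i x -> Phi (x, t) = c i (x, clamp (2 * t - 1)).
  by move=> Aix; rewrite PhiA; [rewrite (ccE i)|exists i].
exists (fun x => Phi (x, 1)), e; split.
  exists Phi; split => // x t Bx; split.
    have [[y By ->//]|[y [s [[i _ Aiy] ->]]]] := PhiB x t Bx.
    by rewrite (ccE i) //; apply: (AB i); have [_ [_ h' _ _]] := hc i y Aiy; exact: h'.
  by move=> i Aix; rewrite (PhiAi i) //; have [_ [_ h' _ _]] := hc i x Aix; exact: h'.
move=> i x Aix; have [Ae [_ _ _ h']] := hc i x Aix.
by rewrite (PhiAi i) // clamp_ge1 ?h' //; lra.
Qed.

(** Each [A_ i] is first collapsed to a point [e i], and [G] is chosen to pass through [e i] at time
    [i]. Then [G \o F] and the collapse agree on all [A_ i], hence are homotopic relative to them as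
    [B] is contractible. Keeping the tracks inside each [A_ i] allows the homotopy to run in all
    coordinates of a tuple at once. *)
Lemma tuple_equiv B (m : nat) (A_ : 'I_m -> set T) (F u : T -> R) h :
  (0 < m)%N -> is_ndr B (\bigcup_i A_ i) u h ->
  ctr R B -> (forall i, ctr R (A_ i)) -> cont_on B F ->
  (forall i x, A_ i x -> F x = i%:R) ->
  exists G : R -> T, [/\ continuous G, forall t, B (G t),
    forall i : 'I_m, A_ i (G i%:R) &
    hmt R B (fun x y => B y /\ forall i, A_ i x -> A_ i y) (G \o F) idfun].
Proof.
move=> m0 ndr ctrB ctrA cF FA.
have AB i x : A_ i x -> B x by move=> Aix; apply: (ndr_sub ndr); exists i.
pose i0 : 'I_m := Ordinal m0; have [b0 _ _] := ctrB.
have [||g [e [idg ge]]] := @ndr_collapse _ i0 b0 B A_ u h ndr.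
- move=> i x Aix.
  have nF : \forall y \near x, B y -> `|i%:R - F y| < 1.
    have := cF x (AB i x Aix); rewrite (FA i x Aix) => /cvgrPdist_lt.
    by move/(_ _ ltr01).
  apply: (filterS _ nF) => y hy j Ajy By; apply/val_inj => /=.
  have := hy By; rewrite (FA j y Ajy) ltr_distl => /andP[h1 h2].
  by apply/eqP; rewrite eqn_leq; apply/andP; split; rewrite -ltnS -(ltr_nat R) -natr1; lra.
- by move=> i _; exact: ctrA.
have Ae i : A_ i (e i) by have [x Aix _] := ctrA i; have [] := ge i x Aix.
pose en k := if insub k is Some i then e i else e i0.
have [|G [cG BG Gi]] := @path_through B en m ctrB.
  by move=> k; rewrite /en; case: insub => [i|]; [exact: (AB i)|exact: (AB i0)].
have Gie (i : 'I_m) : G i%:R = e i by rewrite Gi // /en valK.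
exists G; split => //; first by move=> i; rewrite Gie.
apply: (@hmt_trans _ _ _ _ _ g); last exact: hmt_sym.
have [cg Pg] := hmt_contr idg; have Bg x : B x -> B (g x) by move=> /Pg[].
apply: (hmtW (ndr_homotopic ndr ctrB (cont_on_comp_cont cF cG) cg _ Bg _)) => //.
- by move=> x Bx /=; exact: BG.
- by move=> x [i _ Aix] /=; rewrite (FA i) // Gie; case: (ge i x Aix).
- move=> x y Bx [By yE]; split => // i Aix; rewrite yE; last by exists i.
  by rewrite /= (FA i) // Gie.
Qed.

End TupleEquiv.

(** * The cubical model *)

Section Core.
Context {R : realType} {n : nat}.
Local Notation E := {ptws 'I_n -> R}.
Implicit Types (x y : E) (A : seq nat) (i j k a : nat) (t : R).

(** Numbering coordinates by [nat], with value 0 beyond [n], lets the recursion vary [k] inside one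
    fixed space: M(A, k) and D(A, k) become cylinders whose coordinates from [k] on are free. *)
Definition xcoord x k : R := if insub k is Some i then x i else 0.

Definition upd x k t : E := fun i : 'I_n => if i == k :> nat then t else x i.

Lemma coord_upd x k t j : (k < n)%N ->
  xcoord (upd x k t) j = if j == k then t else xcoord x j.
Proof.
move=> kn; rewrite /xcoord /upd; case: insubP => [i ji <-|jn]; first by [].
by case: eqP => // jk; rewrite jk kn in jn.
Qed.

Lemma coord_ord x (i : 'I_n) : xcoord x i = x i.
Proof. by rewrite /xcoord valK. Qed.

Lemma upd_id x k : upd x k (xcoord x k) = x.
Proof. by apply/funext => i; rewrite /upd; case: eqP => // <-; rewrite coord_ord. Qed.

Lemma cont_on_upd (T : topologicalType) (B : set T) (f : T -> E) (g : T -> R) k :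
  cont_on B f -> cont_on B g -> cont_on B (fun p => upd (f p) k (g p)).
Proof.
move=> cf cg; apply: cont_on_ptws => i; rewrite /upd; case: eqP => _ //.
exact: cont_on_coord.
Qed.

Lemma cont_on_co (T : topologicalType) (B : set T) (f : T -> E) k :
  cont_on B f -> cont_on B (fun p => xcoord (f p) k).
Proof.
move=> cf; rewrite /xcoord; case: insub => [i|]; first exact: cont_on_coord.
exact: cont_on_cst.
Qed.

Definition hits A k x := forall i, i \in A -> exists2 j, (j < k)%N & xcoord x j = i%:R.

(* The line minus the open edges [(a - 1, a)], for [a] in [A] not minimal, has one
   component for each [i] in [A], namely the [t] with [side A i t]. *)
Definition side A i t := forall a, a \in A -> a != head 0%N A ->
  if (a <= i)%N then a%:R <= t else t <= a.-1%:R.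

Definition safe A t := exists2 i, i \in A & side A i t.

(* D(A, k), as a condition on the first [k] coordinates.  D(A, |A|) is the single
   vertex listing [A] in order; the [safe] clause keeps all of M(A, k) over the
   part of the last axis away from the removed edges. *)
Fixpoint core A k x : Prop :=
  if k is k'.+1 then
    if (k < size A)%N then False
    else if k == size A then
      forall j, (j < k)%N -> xcoord x j = (nth 0%N A j)%:R
    else core A k' x \/ (hits A k' x /\ safe A (xcoord x k')) \/
      exists2 i, i \in A & xcoord x k' = i%:R /\ core (rem i A) k' x
  else A = [::].

Lemma core_lt A k x : (k < size A)%N -> core A k x -> False.
Proof. by case: k => [|k] /=; [case: A|move=> ->]. Qed.

Lemma core_size A x : core A (size A) x <->
  forall j, (j < size A)%N -> xcoord x j = (nth 0%N A j)%:R.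
Proof. by case: A => [//|a A] /=; rewrite ltnn eqxx. Qed.

Lemma coreS A k x : (size A <= k)%N -> core A k.+1 x <->
  core A k x \/ (hits A k x /\ safe A (xcoord x k)) \/
      exists2 i, i \in A & xcoord x k = i%:R /\ core (rem i A) k x.
Proof. by move=> Ak /=; rewrite ltnNge leqW //= gtn_eqF. Qed.

Lemma core_nil k x : core [::] k x.
Proof. by elim: k => // k IH; apply/coreS => //; left. Qed.

Lemma hitsS A k x : uniq A -> hits A k.+1 x <->
  hits A k x \/ exists2 i, i \in A & xcoord x k = i%:R /\ hits (rem i A) k x.
Proof.
move=> uA; split; last first.
  case=> [h i /h [j jk e]|[i iA [e h]] a aA]; first by exists j => //; exact: ltnW.
  have [->|ai] := eqVneq a i; first by exists k.
  by have [|j jk ej] := h a; [rewrite mem_rem_uniq // !inE ai|exists j => //; exact: ltnW].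
move=> h; have [[i iA e]|ne] := pselect (exists2 i, i \in A & xcoord x k = i%:R).
  right; exists i => //; split => // a; rewrite mem_rem_uniq // !inE => /andP[ai aA].
  have [j jk ej] := h a aA; exists j => //; rewrite ltn_neqAle -ltnS jk andbT.
  by apply: contra ai => /eqP jk'; rewrite -(eqr_nat R) -ej jk' e.
left=> a aA; have [j jk ej] := h a aA; exists j => //.
rewrite ltn_neqAle -ltnS jk andbT; apply/eqP => jk'.
by apply: ne; exists a; rewrite // -ej jk'.
Qed.

Lemma hits_size A k x : uniq A -> hits A k x -> (size A <= k)%N.
Proof.
elim: k A => [|k IH] A uA; first by case: A uA => // a A _ /(_ a (mem_head _ _)) [].
move/(hitsS _ _ uA) => [/(IH _ uA)|[i iA [_ /(IH _ (rem_uniq _ uA))]]]; first exact: leqW.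
by rewrite size_rem // -ltnS; case: (size A).
Qed.

Lemma sorted_uniq_ltn A : sorted ltn A -> uniq A.
Proof. exact: (sorted_uniq ltn_trans ltnn). Qed.

Lemma sorted_rem i A : sorted ltn A -> sorted ltn (rem i A).
Proof. exact: (subseq_sorted ltn_trans (rem_subseq _ _)). Qed.

Lemma head_le A a : sorted ltn A -> a \in A -> (head 0%N A <= a)%N.
Proof.
case: A => // b A /= pA; rewrite in_cons => /predU1P[->//|aA].
by have /allP /(_ a aA) /= := order_path_min ltn_trans pA; exact: ltnW.
Qed.

Lemma core_hits A k x : uniq A -> core A k x -> hits A k x.
Proof.
elim: k A => [|k IH] A uA; first by move=> /= ->.
have [Ak|] := leqP (size A) k.
  move/(coreS _ Ak) => [/(IH _ uA) h|[[h _]|[i iA [e /(IH _ (rem_uniq _ uA)) h]]]].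
  - by apply/hitsS => //; left.
  - by apply/hitsS => //; left.
  - by apply/hitsS => //; right; exists i.
rewrite leq_eqVlt => /predU1P[e|/core_lt h /h //].
rewrite [X in core A X _]e => /core_size h i iA; exists (index i A).
  by rewrite e index_mem.
by rewrite h ?index_mem // nth_index.
Qed.

(** The component containing [t] is that of the largest element of [A] not above [t], or of the
    minimum of [A] if there is none. *)
Lemma safeP A t : sorted ltn A -> A != [::] ->
  (forall a, a \in A -> a != head 0%N A -> t <= a.-1%:R \/ a%:R <= t) -> safe A t.
Proof.
move=> sA A0 h; pose P i := (i \in A) && (i%:R <= t).
have [[b Pb]|nP] := pselect (exists b, P b).
  have ub i : P i -> (i <= \max_(j <- A) j)%N.
    by move=> /andP[iA _]; exact: leq_bigmax_seq.
  have [i /andP[iA it] imax] := ex_maxnP (ex_intro _ b Pb) ub.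
  exists i => // a aA a0; case: leqP => ai.
    by apply: le_trans it; rewrite ler_nat.
  have [//|at_] := h a aA a0.
  by have := imax a; rewrite /P aA at_ /= leqNgt ai => /(_ isT).
exists (head 0%N A); first by case: (A) A0 => // a A' _; rewrite mem_head.
move=> a aA a0; rewrite leqNgt ltn_neqAle eq_sym a0 head_le //=.
have [//|at_] := h a aA a0.
by case: nP; exists a; rewrite /P aA.
Qed.

Lemma safe_nat A k : sorted ltn A -> A != [::] -> safe A k%:R.
Proof.
move=> sA A0; apply: safeP => // a aA a0; rewrite !ler_nat.
by case: (leqP a k) => ak; [right|left; case: (a) ak].
Qed.

Lemma side_self A i : side A i i%:R.
Proof. by move=> a _ _; case: leqP => ai; rewrite ler_nat //; case: (a) ai. Qed.

(** Two different components are separated by a removed unit edge, namely the one ending at the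
    larger of [i] and [j]. *)
Lemma side_sep A i j t s : sorted ltn A -> i \in A -> j \in A ->
  side A i t -> side A j s -> `|t - s| < 1 -> i = j.
Proof.
have key i' j' t' s' : sorted ltn A -> i' \in A -> j' \in A ->
    side A i' t' -> side A j' s' -> (i' < j')%N -> t' + 1 <= s'.
  move=> sA iA jA si sj ij.
  have j0 : j' != head 0%N A.
    by apply: contraTneq ij => ->; rewrite -leqNgt head_le.
  have := si j' jA j0; have := sj j' jA j0; rewrite leqnn leqNgt ij /= => h1 h2.
  apply: le_trans h1; rewrite -(ltn_predK ij) -natr1; lra.
move=> sA iA jA si sj; rewrite ltr_distl => /andP[h1 h2].
case: (ltngtP i j) => // ij; exfalso; [have := key i j t s sA iA jA si sj ij|
  have := key j i s t sA jA iA sj si ij]; lra.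
Qed.

(** Geometrically a dimension count: the cells missing from D(A - i, k) have dimension one more than
    M(A, k). The induction follows the last coordinate; if it equals [i], the [safe] clause applies,
    all integers being outside the removed open edges. *)
Lemma hits_core A i k x : sorted ltn A -> i \in A -> hits A k x -> core (rem i A) k x.
Proof.
elim: k A => [|k IH] A sA iA h.
  by have := hits_size (sorted_uniq_ltn sA) h; rewrite leqn0 => /nilP A0; rewrite A0 in iA.
have uA := sorted_uniq_ltn sA.
have Ak : (size (rem i A) <= k)%N.
  by rewrite size_rem // -ltnS (leq_trans _ (hits_size uA h)) //; case: (A) iA.
apply/coreS => //; move/(hitsS _ _ uA) : h => [h|[j jA [e h]]].
  by left; exact: IH.
have [ji|ji] := eqVneq j i.
  have [->|A0] := eqVneq (rem i A) [::]; first by left; exact: core_nil.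
  right; left; rewrite -ji; split; first by [].
  by rewrite e; apply: safe_nat; [exact: sorted_rem|rewrite ji].
right; right; exists j; first by rewrite mem_rem_uniq // !inE ji.
split => //.
have -> : rem j (rem i A) = rem i (rem j A).
  by rewrite !rem_filter ?filter_uniq // -!filter_predI; apply: eq_filter => b /=; rewrite andbC.
by apply: IH; [exact: sorted_rem|rewrite mem_rem_uniq // !inE eq_sym ji|].
Qed.

Lemma hits_eq A k x y : (forall j, (j < k)%N -> xcoord x j = xcoord y j) ->
  hits A k x -> hits A k y.
Proof. by move=> xy h i /h [j jk e]; exists j; rewrite -?xy. Qed.

Lemma core_eq A k x y : (forall j, (j < k)%N -> xcoord x j = xcoord y j) ->
  core A k x -> core A k y.
Proof.
elim: k A => [|k IH] A xy //.
have xyk j : (j < k)%N -> xcoord x j = xcoord y j by move=> jk; apply: xy; exact: ltnW.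
rewrite /=; case: ifP => // _; case: ifP => // _.
  by move=> h j jk; rewrite -xy // h.
rewrite -xy //; move=> [/(IH _ xyk)|[[h s]|[i iA [e /(IH _ xyk) h]]]]; first by left.
  by right; left; split => //; exact: hits_eq h.
by right; right; exists i.
Qed.

Section Cub.
Context (L : nat).

Lemma face_coord x y k z : face L x y -> (z <= L)%N ->
  (xcoord x k <= z%:R -> xcoord y k <= z%:R) /\ (z%:R <= xcoord x k -> z%:R <= xcoord y k).
Proof. by move=> xy zL; rewrite /xcoord; case: insub => [i|] //; exact: xy. Qed.

Lemma face_coordE x y k z : face L x y -> (z <= L)%N -> xcoord x k = z%:R -> xcoord y k = z%:R.
Proof.
move=> xy zL e; have [h1 h2] := face_coord k xy zL.
by apply: le_anti; rewrite h1 ?h2 // e.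
Qed.

Lemma hits_cubical A k : {in A, forall a, (a <= L)%N} -> cubical L (hits A k).
Proof.
move=> AL x y h xy i iA; have [j jk e] := h i iA; exists j => //.
by apply: face_coordE xy _ e; exact: AL.
Qed.

Lemma face_side A i k x y : {in A, forall a, (a <= L)%N} -> face L x y ->
  side A i (xcoord x k) -> side A i (xcoord y k).
Proof.
move=> AL xy h a aA a0; have := h a aA a0; case: leqP => ai.
  by have [] := face_coord k xy (AL a aA).
by have [] := face_coord k xy (leq_trans (leq_pred a) (AL a aA)).
Qed.

Lemma face_safe A k x y : {in A, forall a, (a <= L)%N} -> face L x y ->
  safe A (xcoord x k) -> safe A (xcoord y k).
Proof. by move=> AL xy [i iA s]; exists i => //; exact: face_side xy s. Qed.

Lemma core_cubical A k : {in A, forall a, (a <= L)%N} -> cubical L (core A k).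
Proof.
elim: k A => [|k IH] A AL x y //=; case: ifP => // _; case: ifP => [/eqP e h xy j jk|_].
  by apply: face_coordE xy _ (h j jk); apply: AL; rewrite mem_nth // -e.
move=> + xy; case=> [h|[[h s]|[i iA [e h]]]].
- by left; apply: IH h xy.
- by right; left; split; [apply: hits_cubical h xy|exact: face_safe xy s].
- right; right; exists i => //; split; first by apply: face_coordE xy _ e; exact: AL.
  by apply: IH h xy => a /mem_rem; exact: AL.
Qed.

End Cub.
End Core.
Arguments side_self {R} A i.

Section ClosedProd.
Context {T U : topologicalType}.

Lemma closed_setXT (A : set T) : closed A -> closed (A `*` [set: U]).
Proof.
move=> clA [x t] clx; split => //=; apply: clA => V nV.
have [|[y s] [[/= Ay _] Vy]] := clx (fst @^-1` V); last by exists y.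
exact: (@cvg_fst T U (nbhs x) (nbhs t) _ _ nV).
Qed.

End ClosedProd.

(** * Contractibility of the core *)

Section CoreCtr.
Context {R : realType} {n : nat} (L : nat).
Local Notation E := {ptws 'I_n -> R}.
Implicit Types (x y : E) (A : seq nat) (k : nat) (t : R).

Lemma star_ctr (B : set E) (e : E) : B e ->
  (forall x t, B x -> B (fun v => (1 - t) * x v + t * e v)) -> ctr R B.
Proof.
move=> Be star; exists e => //.
exists (fun p v => (1 - p.2) * p.1 v + p.2 * e v); split => //=.
- apply: cont_on_ptws => v; apply: cont_onD; apply: cont_onM.
  + by apply: cont_onB; [exact: cont_on_cst|exact: cont_on_snd].
  + by apply: (@cont_on_coord _ _ _ _ (fst : E * R -> E)); exact: cont_on_fst.
  + exact: cont_on_snd.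
  + exact: cont_on_cst.
- by move=> x _; apply/funext => v; rewrite subr0 mul1r mul0r addr0.
- by move=> x _; apply/funext => v; rewrite subrr mul1r mul0r add0r.
Qed.

(** In place of an explicit retraction, the parts [C_ i] above the components of the cut line are
    collapsed by a map [g] homotopic to the identity. After [g], the last coordinate no longer
    matters within a component, and contracting D(A, k) in the first [k] coordinates extends by a
    constant homotopy over all [C_ i]. *)
Lemma core_ctr A k : sorted ltn A -> {in A, forall a, (a <= L)%N} ->
  (size A <= k)%N -> (k <= n)%N -> ctr R (@core R n A k).
Proof.
elim: k A => [|k IH] A sA AL Ak kn.
  have -> : A = [::] by case: A Ak {sA AL}.
  exact: (@star_ctr _ (fun=> 0)).
move: Ak; rewrite leq_eqVlt => /predU1P[Ak|Ak].
  (* Here the core prescribes the first [size A] coordinates and leaves the others free, so it is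
     star-shaped. *)
  have core0 x : core A k.+1 x <-> forall j, (j < size A)%N -> xcoord x j = (nth 0%N A j)%:R.
    by rewrite -Ak; exact: core_size.
  have ceq (f : nat -> R) j : xcoord ((fun v : 'I_n => f v) : E) j = if (j < n)%N then f j else 0.
    by rewrite /xcoord; case: insubP => [i -> <-|/negPf ->].
  apply: (@star_ctr _ (fun v : 'I_n => (nth 0%N A v)%:R)).
    apply/core0 => j jA; rewrite (ceq (fun v => (nth 0%N A v)%:R)) ifT //.
    by rewrite (leq_trans jA) // Ak.
  move=> x t /core0 h; apply/core0 => j jA.
  have jn : (j < n)%N by rewrite (leq_trans jA) // Ak.
  have := h j jA; rewrite /xcoord insubT /= => ->.
  by rewrite mulrBl mul1r subrK.
rewrite ltnS in Ak; have uA := sorted_uniq_ltn sA.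
have [A0|A0] := eqVneq A [::].
  by rewrite A0; apply: (@star_ctr _ (fun=> 0)) => *; exact: core_nil.
set B : set E := core A k.+1.
have BP x : B x <-> core A k x \/ (hits A k x /\ safe A (xcoord x k)) \/
      exists2 i, i \in A & xcoord x k = i%:R /\ core (rem i A) k x by exact: coreS.
have updk x t : xcoord (upd x k t) k = t by rewrite coord_upd // eqxx.
have updj x t j : (j < k)%N -> xcoord x j = xcoord (upd x k t) j.
  by move=> jk; rewrite coord_upd // ltn_eqF.
have updcore A' x t : core A' k x -> core A' k (upd x k t).
  by apply: core_eq => j; exact: updj.
have updhits A' x t : hits A' k x -> hits A' k (upd x k t).
  by apply: hits_eq => j; exact: updj.
pose E0 : set E := core A k.
have [e0 E0e0 [c0 [cc0 E0c0 c00 c01]]] : ctr R E0 by apply: IH => //; exact: ltnW.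
have E0B x : E0 x -> B x by move=> h; apply/BP; left.
pose C_ (i : nat) : set E := [set x | [/\ B x, i \in A & side A i (xcoord x k)]].
have E0C x i : E0 x -> i \in A -> side A i (xcoord x k) -> C_ i x.
  by move=> h iA s; split => //; exact: E0B.
(* Above the component of [i] all three clauses of [core] put the first [k] coordinates into D(A -
   i, k): the first two through [hits_core], the third because a last coordinate [j] in that
   component forces [j = i]. *)
have Ccore i x : C_ i x -> core (rem i A) k x.
  move=> [/BP + iA s]; case=> [h|[[h _]|[j jA [e h]]]].
  - by apply: hits_core => //; exact: core_hits.
  - exact: hits_core.
  - suff -> : i = j by [].
    have := @side_self R A j.
    by move=> sj; apply: (side_sep sA iA jA s sj); rewrite e subrr normr0.
have Cvertex i x : i \in A -> core (rem i A) k x -> C_ i (upd x k i%:R).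
  move=> iA h; split => //; last by rewrite updk; exact: side_self.
  by apply/BP; right; right; exists i => //; split => //; exact: updcore.
have Cctr i : C_ i !=set0 -> ctr R (C_ i).
  move=> [_ [_ iA _]].
  have [||||ei Cei [ci [cci Cci ci0 ci1]]] := IH (rem i A).
  - exact: sorted_rem.
  - by move=> a /mem_rem; exact: AL.
  - by rewrite size_rem // (leq_trans (leq_pred _)).
  - exact: ltnW.
  exists (upd ei k i%:R); first exact: Cvertex.
  (* First slide the last coordinate to [i] inside its component, then contract D(A - i, k) with the
     last coordinate held at [i]. *)
  apply: (@hmt_trans _ _ _ _ _ (fun x => upd x k i%:R)).
    apply: (@hmt_unit _ _ _ _ _ _ _
      (fun p : E * R => upd p.1 k ((1 - p.2) * xcoord p.1 k + p.2 * i%:R))) => /=.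
    + apply: cont_on_upd; first exact: cont_on_fst.
      apply: cont_onD; apply: cont_onM.
      * by apply: cont_onB; [exact: cont_on_cst|exact: cont_on_snd].
      * by apply: cont_on_co; exact: cont_on_fst.
      * exact: cont_on_snd.
      * exact: cont_on_cst.
    + move=> x t Cx t0 t1; have [Bx _ s] := Cx.
      have sc : side A i ((1 - t) * xcoord x k + t * i%:R).
        move=> a aA a0; have := s a aA a0; have := @side_self R A i a aA a0.
        case: leqP => _ h1 h2; nra.
      have Cx' := Ccore i x Cx.
      move/BP : (Bx) => [h|[[h _]|[j jA [e h]]]].
      * by apply: E0C; rewrite ?updk //; exact: updcore.
      * split => //; last by rewrite updk.
        by apply/BP; right; left; split; [exact: updhits|rewrite updk; exists i].
      * have ij : i = j.
          apply: (side_sep sA iA jA s (@side_self R A j)).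
          by rewrite e subrr normr0.
        by rewrite e -ij mulrBl mul1r subrK; exact: Cvertex.
    + by move=> x _; rewrite subr0 mul1r mul0r addr0 upd_id.
    + by move=> x _; rewrite subrr mul0r mul1r add0r.
  exists (fun p => upd (ci p) k i%:R); split => //=.
  + apply: cont_on_upd; last exact: cont_on_cst.
    by apply: cont_onW cci => -[x t] [/= /Ccore].
  + by move=> x t /Ccore Cx; apply: Cvertex => //; exact: Cci.
  + by move=> x /Ccore Cx; rewrite ci0.
  + by move=> x /Ccore Cx; rewrite ci1.
pose C : set E := \bigcup_i C_ i.
have CP x : C x <-> B x /\ safe A (xcoord x k).
  split=> [[i _ [Bx iA s]]|[Bx [i iA s]]]; last by exists i.
  by split => //; exists i.
have AS i : i \in A -> (i <= L)%N by exact: AL.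
have Bcub : cubical L B by exact: core_cubical.
have Ccub : cubical L C.
  move=> x y /CP[Bx s] xy; apply/CP; split; first exact: Bcub Bx xy.
  exact: face_safe xy s.
have E0cub : cubical L E0 by exact: core_cubical.
have [i1 i1A] : exists i, i \in A by case: (A) A0 => // a A' _; exists a; rewrite mem_head.
have CB : C `<=` B by move=> x /CP[].
have Cn0 : C !=set0.
  exists (upd e0 k i1%:R), i1 => //.
  by apply: E0C; rewrite ?updk; [exact: updcore| |exact: side_self].
have [u [h ndr]] := cubical_ndr Ccub Bcub CB Cn0.
have [||g [e [idg ge]]] := @ndr_collapse R E nat 0%N e0 B C_ u h ndr.
- move=> i x [Bx iA s].
  have nk : \forall y \near x, `|xcoord x k - xcoord y k| < 1.
    have : cont_on setT (fun y => xcoord y k) by exact/cont_on_co/cont_on_id.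
    by move=> /cont_onT /(_ x) /cvgrPdist_lt /(_ _ ltr01).
  by apply: filterS nk => y xy j [By jA sj] _; apply: (side_sep sA jA iA sj s); rewrite distrC.
- exact: Cctr.
have [cg Bg0] := hmt_contr idg; have Bg x : B x -> B (g x) by move=> /Bg0 [].
have gC i x y : C_ i x -> C_ i y -> g x = g y by move=> /ge[-> _] /ge[-> _].
pose v x := upd e0 k (xcoord x k).
have E0v t : E0 (upd e0 k t) by apply: updcore.
exists (g (upd e0 k 0)); first by apply/Bg/E0B/E0v.
apply: (@hmt_trans _ _ _ _ _ g); first by apply: hmtW idg _ _ _ _ => // x y _ [].
apply: (@hmt_trans _ _ _ _ _ (g \o v)); last first.
  exists (fun p => g (upd e0 k ((1 - p.2) * xcoord p.1 k))); split => /=.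
  - apply: (@cont_on_comp _ _ _ _ B (fun p : E * R => upd e0 k ((1 - p.2) * xcoord p.1 k)) g) cg _.
      apply: cont_on_upd; first exact: cont_on_cst.
      apply: cont_onM; last by apply: cont_on_co; exact: cont_on_fst.
      by apply: cont_onB; [exact: cont_on_cst|exact: cont_on_snd].
    by move=> p _; apply: E0B; exact: E0v.
  - by move=> x t _; apply/Bg/E0B/E0v.
  - by move=> x _; rewrite subr0 mul1r.
  - by move=> x _; rewrite subrr mul0r.
have vC i x : C_ i x -> C_ i (v x).
  by move=> [_ iA s]; apply: E0C; rewrite /v ?updk //; exact: E0v.
(* The two prescriptions agree on the overlap: moving by [c0] with the last coordinate fixed does
   not leave [C_ i], on which [g] is constant. *)
pose G (p : E * R) := if `[< C p.1 >] then g p.1 else g (upd (c0 p) k (xcoord p.1 k)).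
have GE0 x t : E0 x -> G (x, t) = g (upd (c0 (x, t)) k (xcoord x k)).
  move=> E0x; rewrite /G; case: asboolP => //= -[i _ Cix]; apply: (gC i) => //.
  by have [_ iA s] := Cix; apply: E0C; rewrite ?updk //; apply: updcore; exact: E0c0.
have BCE x : B x -> C x \/ E0 x.
  move=> Bx; move/BP : (Bx) => [Eh|[[_ s]|[i iA [ek _]]]]; first by right.
    by left; apply/CP.
  by left; apply/CP; split => //; rewrite ek; exists i => //; exact: side_self.
exists G; split.
- apply: (@cont_on_closedU _ _ _ (C `*` setT) (E0 `*` setT)).
  + exact/closed_setXT/(cubical_closed Ccub).
  + exact/closed_setXT/(cubical_closed E0cub).
  + by move=> [x t] [/= /BCE [] h' _]; [left|right].
  + apply: (@cont_on_ext _ _ _ (fun p : E * R => g p.1)).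
      by apply: cont_onW (cont_on_pairl (B := setT) cg) => p [].
    by move=> [x t] [_ [/= Cx _]]; rewrite /G asboolT.
  + apply: (@cont_on_ext _ _ _ (fun p : E * R => g (upd (c0 p) k (xcoord p.1 k)))).
      apply: (@cont_on_comp _ _ _ _ B (fun p : E * R => upd (c0 p) k (xcoord p.1 k)) g) cg _.
        apply: cont_on_upd; first by apply: cont_onW cc0 => p [_].
        by apply: cont_on_co; exact: cont_on_fst.
      by move=> [x t] [_ [/= E0x _]]; apply: E0B; apply: updcore; exact: E0c0.
    by move=> [x t] [_ [/= E0x _]]; rewrite GE0.
- move=> x t /[dup] Bx /BCE [Cx|E0x]; first by rewrite /G asboolT //; exact: Bg.
  by rewrite GE0 //; apply/Bg/E0B; apply: updcore; exact: E0c0.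
- move=> x /[dup] Bx /BCE [Cx|E0x]; first by rewrite /G asboolT.
  by rewrite GE0 // c00 // upd_id.
- move=> x /[dup] Bx /BCE [Cx|E0x].
    by rewrite /G asboolT //; case: Cx => i _ Cix; apply: (gC i) => //; exact: vC.
  by rewrite GE0 // c01.
Qed.

End CoreCtr.

(** * The cells outside the core *)

Section Cells.
Context {R : realType} {n : nat}.
Local Notation E := {ptws 'I_n -> R}.
Implicit Types (x y : E) (A : seq nat) (i j k a : nat) (t : R).
Implicit Types (l : nat * bool) (w : seq (nat * bool)).

(* A letter [(a, false)] is the point [a], a letter [(a, true)] the edge from
   [a - 1] to [a]; a word is a product of such cells. *)
Definition lopen l t := if l.2 then l.1.-1%:R < t < l.1%:R else t == l.1%:R.
Definition lclosed l t := if l.2 then l.1.-1%:R <= t <= l.1%:R else t == l.1%:R.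

Definition copen w x :=
  forall j, (j < size w)%N -> lopen (nth (0%N, false) w j) (xcoord x j).
Definition cclosed w x :=
  forall j, (j < size w)%N -> lclosed (nth (0%N, false) w j) (xcoord x j).

Lemma lopenW l t : lopen l t -> lclosed l t.
Proof. by rewrite /lopen /lclosed; case: ifP => // _ /andP[/ltW -> /ltW ->]. Qed.

Lemma copenW w x : copen w x -> cclosed w x.
Proof. by move=> h j jw; exact/lopenW/h. Qed.

Lemma rcons_cell (P : nat * bool -> R -> bool) w l x :
  (forall j, (j < size (rcons w l))%N -> P (nth (0%N, false) (rcons w l) j) (xcoord x j)) <->
  (forall j, (j < size w)%N -> P (nth (0%N, false) w j) (xcoord x j)) /\
  P l (xcoord x (size w)).
Proof.
split=> [h|[h hl] j].
  split=> [j jw|].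
    by have := h j; rewrite size_rcons nth_rcons jw ltnS ltnW //; exact.
  by have := h (size w); rewrite size_rcons nth_rcons ltnn eqxx ltnSn; exact.
rewrite size_rcons nth_rcons ltnS leq_eqVlt => /predU1P[->|jw].
  by rewrite ltnn eqxx.
by rewrite jw; exact: h.
Qed.

(** The cells outside [core A k], clause by clause: [p != A] because the sorted ordering is the
    vertex kept in the core, [behead A] because no removed edge ends at the minimum of [A]. *)
Fixpoint cells A k : seq (seq (nat * bool)) :=
  if k is k'.+1 then
    if (k < size A)%N then [::]
    else if k == size A then
      [seq [seq (a, false) | a <- p] | p <- permutations A & p != A]
    else [seq rcons w (a, true) | a <- behead A, w <- cells A k'] ++
      [seq rcons w (i, false) | i <- A, w <- cells (rem i A) k']
  else [::].

Lemma cells_size A : cells A (size A) =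
  [seq [seq (a, false) | a <- p] | p <- permutations A & p != A].
Proof. by case: A => [|a A] //=; rewrite ltnn eqxx. Qed.

Lemma cellsS A k : (size A <= k)%N -> cells A k.+1 =
  [seq rcons w (a, true) | a <- behead A, w <- cells A k] ++
  [seq rcons w (i, false) | i <- A, w <- cells (rem i A) k].
Proof. by move=> Ak /=; rewrite ltnNge leqW //= gtn_eqF. Qed.

Lemma mem_behead_uniq A a : uniq A -> a \in behead A -> a \in A /\ a != head 0%N A.
Proof.
case: A => // b A /= /andP[bA _] aA; rewrite in_cons aA orbT; split => //.
by apply: contraNneq bA => <-.
Qed.

Lemma behead_mem A a : a \in A -> a != head 0%N A -> a \in behead A.
Proof. by case: A => // b A; rewrite in_cons /= => /predU1P[->|//]; rewrite eqxx. Qed.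

Lemma cells_ind (P : seq nat -> nat -> seq (nat * bool) -> Prop) :
  (forall A p, sorted ltn A -> perm_eq p A -> p != A ->
    P A (size A) [seq (a, false) | a <- p]) ->
  (forall A k w a, sorted ltn A -> (size A <= k)%N -> w \in cells A k -> P A k w ->
    a \in A -> a != head 0%N A -> P A k.+1 (rcons w (a, true))) ->
  (forall A k w i, sorted ltn A -> (size A <= k)%N -> w \in cells (rem i A) k ->
    P (rem i A) k w -> i \in A -> P A k.+1 (rcons w (i, false))) ->
  forall A k w, sorted ltn A -> w \in cells A k -> P A k w.
Proof.
move=> Pbase Pedge Ppt A k; elim: k A => [//|k IH] A w sA.
case: (ltngtP (size A) k.+1) => [Ak|Ak|Ak].
- rewrite ltnS in Ak; rewrite cellsS // mem_cat.
  case/orP => /allpairsPdep [a [w' [aA ww ->]]].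
    have [aA' a0] := mem_behead_uniq (sorted_uniq_ltn sA) aA.
    by apply: Pedge => //; exact: IH.
  by apply: Ppt => //; apply: IH => //; exact: sorted_rem.
- by rewrite /= Ak.
- rewrite -Ak cells_size => /mapP[p]; rewrite mem_filter mem_permutations.
  by move=> /andP[pA pp] ->; exact: Pbase.
Qed.

(** The number of edge letters is the dimension of the cell. An edge letter ends at a non-minimal,
    hence positive, element of [A], so the truncated predecessor in [lopen] and [lclosed] is a true
    one. *)
Lemma cells_props A k w : sorted ltn A -> w \in cells A k ->
  [/\ size w = k, (count snd w + size A = k)%N,
    {in w, forall l, l.1 \in A} & {in w, forall l, l.2 -> (0 < l.1)%N}].
Proof.
move: A k w; apply: cells_ind.
- move=> A p sA pA _; split; first by rewrite size_map (perm_size pA).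
  + by rewrite count_map (eq_count (a2 := pred0)) // count_pred0.
  + by move=> _ /mapP[a ap ->]; rewrite /= -(perm_mem pA).
  + by move=> _ /mapP[a ap ->].
- move=> A k w a sA Ak _ [w1 w2 w3 w4] aA a0; split.
  + by rewrite size_rcons w1.
  + by rewrite -cats1 count_cat /= addn0 addn1 addSn w2.
  + by move=> l; rewrite mem_rcons in_cons => /predU1P[->//|]; exact: w3.
  + move=> l; rewrite mem_rcons in_cons => /predU1P[-> _|]; last exact: w4.
    rewrite lt0n; apply: contraNneq a0 => /= e; have := head_le sA aA.
    by rewrite e leqn0 eq_sym.
- move=> A k w i sA Ak _ [w1 w2 w3 w4] iA; split.
  + by rewrite size_rcons w1.
  + rewrite -cats1 count_cat /= !addn0 -w2 size_rem // -addnS prednK //.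
    by case: (A) iA.
  + by move=> l; rewrite mem_rcons in_cons => /predU1P[->//|/w3/mem_rem].
  + by move=> l; rewrite mem_rcons in_cons => /predU1P[->//|]; exact: w4.
Qed.

Lemma cells_hits A k w x : sorted ltn A -> w \in cells A k -> cclosed w x -> hits A k x.
Proof.
move: A k w; apply: cells_ind.
- move=> A p sA pA _ h i; rewrite -(perm_mem pA) => ip; exists (index i p).
    by rewrite -(perm_size pA) index_mem.
  have := h (index i p); rewrite size_map index_mem ip (nth_map 0%N) ?index_mem //.
  by rewrite nth_index // => /(_ isT) /eqP.
- move=> A k w a sA Ak wc IH aA a0 /rcons_cell[/IH h _].
  by apply: (hitsS _ _ (sorted_uniq_ltn sA)).2; left.
- move=> A k w i sA Ak wc IH iA /rcons_cell[/IH h].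
  have [-> _ _ _] := cells_props (sorted_rem i sA) wc.
  by move=> /eqP e; apply: (hitsS _ _ (sorted_uniq_ltn sA)).2; right; exists i.
Qed.

Lemma nat_gap (z a : nat) : ~~ (a.-1%:R < z%:R :> R) || ~~ (z%:R < a%:R :> R).
Proof. by rewrite !ltr_nat -!leqNgt; case: a => [|a] /=; [rewrite orbT|rewrite ltnNge orbN]. Qed.

Lemma copen_core A k w x : sorted ltn A -> w \in cells A k -> copen w x -> ~ core A k x.
Proof.
move: A k w; apply: cells_ind.
- move=> A p sA pA ppA h /core_size h'; move/eqP : ppA; apply.
  apply: (@eq_from_nth _ 0%N); first exact: perm_size.
  move=> j jp; apply/eqP; rewrite -(eqr_nat R) -h' -?(perm_size pA) //.
  by have := h j; rewrite size_map (nth_map 0%N) // => /(_ jp) /eqP <-.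
- move=> A k w a sA Ak wc IH aA a0 /rcons_cell[/IH h].
  have [-> _ _ _] := cells_props sA wc; rewrite /lopen /= => /andP[x1 x2].
  move=> /(coreS _ Ak) [//|[[_ [i iA s]]|[i iA [e _]]]].
    by have := s a aA a0; case: leqP => _; lra.
  by have := nat_gap i a; rewrite -e x1 x2.
- move=> A k w i sA Ak wc IH iA /rcons_cell[/IH h].
  have [-> _ _ _] := cells_props (sorted_rem i sA) wc; rewrite /lopen /= => /eqP xi.
  (* Each clause yields [core (rem i A) k x], against the induction hypothesis; the first two do so
     through [hits_core]. *)
  move=> /(coreS _ Ak) [c|[[c _]|[j jA [e c]]]]; apply: h.
  + by apply: hits_core => //; apply: core_hits => //; exact: sorted_uniq_ltn.
  + exact: hits_core.
  + by suff -> : i = j by []; apply/eqP; rewrite -(eqr_nat R) -xi e.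
Qed.

Lemma hits_perm A x : uniq A -> hits A (size A) x ->
  exists2 p, perm_eq p A & forall j, (j < size A)%N -> xcoord x j = (nth 0%N p j)%:R.
Proof.
move sk : (size A) => k; elim: k A sk => [|k IH] A sk uA.
  by move/size0nil : sk => -> _; exists [::].
move/(hitsS _ _ uA) => [/(hits_size uA)|[i iA [e h]]]; first by rewrite sk ltnn.
have [||p pA px] := IH (rem i A) _ _ h; first by rewrite size_rem // sk.
  exact: rem_uniq.
have sp : size p = k by rewrite (perm_size pA) size_rem // sk.
exists (rcons p i).
  by rewrite perm_rcons perm_sym (permPl (perm_to_rem iA)) perm_cons perm_sym.
move=> j; rewrite ltnS leq_eqVlt nth_rcons sp => /predU1P[->|jk].
  by rewrite ltnn eqxx.
by rewrite jk px.
Qed.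

Lemma cells_cover A k x : sorted ltn A -> hits A k x -> ~ core A k x ->
  exists2 w, w \in cells A k & copen w x.
Proof.
elim: k A => [|k IH] A sA h nc.
  by case: nc; have := hits_size (sorted_uniq_ltn sA) h; rewrite leqn0 => /nilP.
have uA := sorted_uniq_ltn sA; have := hits_size uA h.
rewrite leq_eqVlt => /predU1P[Ak|Ak].
  move: h nc; rewrite -Ak => h /core_size nc; rewrite cells_size.
  have [p pA px] := hits_perm uA h; exists [seq (a, false) | a <- p].
    apply: map_f; rewrite mem_filter mem_permutations pA andbT.
    by apply/eqP => e; apply: nc => j /px ->; rewrite e.
  move=> j; rewrite size_map => jp; rewrite (nth_map 0%N) //.
  by rewrite /lopen /= px // -(perm_size pA).
rewrite ltnS in Ak; rewrite cellsS //.
move/(coreS _ Ak) : nc => /not_orP[nc /not_orP[ns np]].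
move/(hitsS _ _ uA) : h => [h|[i iA [e h]]].
  have [w wc wx] := IH A sA h nc.
  have A0 : A != [::] by apply: contra_notN nc => /eqP ->; exact: core_nil.
  have : ~ safe A (xcoord x k) by move=> s; apply: ns.
  move=> /(contra_not (safeP sA A0)) /existsNP[a /not_implyP[aA /not_implyP[a0]]].
  move=> /not_orP[/negP + /negP]; rewrite -!ltNge => x1 x2.
  exists (rcons w (a, true)).
    by rewrite mem_cat; apply/orP; left; apply: allpairs_f_dep => //; exact: behead_mem.
  apply/rcons_cell; split => //; have [-> _ _ _] := cells_props sA wc.
  by rewrite /lopen /= x1 x2.
have [||w wc wx] := IH (rem i A) _ h; first exact: sorted_rem.
  by move=> c; apply: np; exists i.
exists (rcons w (i, false)).
  by rewrite mem_cat; apply/orP; right; apply: allpairs_f_dep.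
apply/rcons_cell; split => //; have [-> _ _ _] := cells_props (sorted_rem i sA) wc.
by rewrite /lopen /= e.
Qed.

Lemma letter_face l l' t : lclosed l t -> lopen l' t -> (l'.2 -> l = l') /\
  (~~ l.2 -> l = l').
Proof.
case: l l' => [a b] [a' b']; rewrite /lclosed /lopen /=.
case: b; case: b'; last by move=> /eqP -> /eqP /eqP; rewrite eqr_nat => /eqP ->.
- move=> /andP[h1 h2] /andP[h3 h4]; split => // _; congr pair.
  have : (a'.-1%:R < a%:R :> R) by lra.
  have : (a.-1%:R < a'%:R :> R) by lra.
  by rewrite !ltr_nat; case: a {h1 h2} => [|a]; case: a' {h3 h4} => [|a'] //=; lia.
- by [].
- by move=> /eqP -> /andP[h3 h4]; have := nat_gap a a'; rewrite h3 h4.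
Qed.

(** An open cell that meets a closed cell is a face of it, and a face of the same dimension is the
    whole cell. *)
Lemma cell_face w w' x : size w = size w' -> count snd w = count snd w' ->
  cclosed w x -> copen w' x -> w = w'.
Proof.
move=> sw cw h h'.
have {h h'} : forall j, (j < size w)%N ->
    ((nth (0%N, false) w' j).2 -> nth (0%N, false) w j = nth (0%N, false) w' j) /\
    (~~ (nth (0%N, false) w j).2 -> nth (0%N, false) w j = nth (0%N, false) w' j).
  move=> j jw; apply: (@letter_face _ _ (xcoord x j)); first exact: h.
  by apply: h'; rewrite -sw.
suff H : (forall j, (j < size w)%N ->
    ((nth (0%N, false) w' j).2 -> nth (0%N, false) w j = nth (0%N, false) w' j) /\
    (~~ (nth (0%N, false) w j).2 -> nth (0%N, false) w j = nth (0%N, false) w' j)) ->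
    (count snd w' <= count snd w)%N /\ (count snd w = count snd w' -> w = w').
  by move/H => [_]; apply.
elim: w w' sw {cw} => [|l w IH] [|l' w'] //= [sw] h.
have [h1 h2] := h 0%N isT; have [|c1 c2] := IH w' sw; first by move=> j jw; exact: (h j.+1).
rewrite /= in h1 h2.
case: l' h1 h2 {h} => [a' b']; case: l => [a b] /=; case: b'; case: b => h1 h2.
- by split=> [|/addnI e]; [rewrite leq_add2l|rewrite h1 // c2].
- by have := h1 isT.
- by split=> [|e]; [|exfalso]; lia.
- by split=> [|/addnI e]; [rewrite leq_add2l|rewrite h2 // c2].
Qed.

Lemma cells_uniq A k : sorted ltn A -> uniq (cells A k).
Proof.
elim: k A => [//|k IH] A sA.
case: (ltngtP (size A) k.+1) => [Ak|Ak|Ak]; last first.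
- rewrite -Ak cells_size map_inj_uniq ?filter_uniq ?permutations_uniq //.
  by apply: inj_map => a b [].
- by rewrite /= Ak.
rewrite ltnS in Ak; have uA := sorted_uniq_ltn sA; rewrite cellsS // cat_uniq; apply/and3P; split.
- apply: allpairs_uniq; [by case: (A) uA => //= a A' /andP[]|exact: IH|].
  by move=> [a w] [b w'] _ _ /= /rcons_inj[-> ->].
- apply/hasP => -[_ /allpairsPdep[i [w [_ _ ->]]] /allpairsPdep[a [w' [_ _]]]].
  by move=> /rcons_inj[].
- apply: allpairs_uniq_dep => //; first by move=> i _; apply: IH; exact: sorted_rem.
  by move=> [i w] [j w'] _ _ /= /rcons_inj[-> ->].
Qed.

End Cells.

(** * The number of removed cells *)

Section Counting.
Implicit Types m n k : nat.

(** Termwise, from (m + 1) C(m, a + 1) = (m - a) C(m + 1, a + 1); the sum for [m] is first extended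
    to [a = m], where the binomial vanishes. *)
Lemma stirling_countS m n : stirling_count m.+1 n.+1 =
  m%:Z * stirling_count m.+1 n + m.+1%:Z * stirling_count m n.
Proof.
rewrite /stirling_count.
have -> : \sum_(1 <= a < m) (-1) ^+ (m + a + 1) * 'C(m, a.+1)%:Z * a%:Z ^+ n =
    \sum_(1 <= a < m.+1) (-1) ^+ (m + a + 1) * 'C(m, a.+1)%:Z * a%:Z ^+ n :> int.
  case: m => [|m]; first by rewrite !big_geq.
  by rewrite [RHS]big_nat_recr //= bin_small // mulr0 mul0r addr0.
rewrite !mulr_sumr -big_split /=; apply: eq_big_nat => a /andP[_ am].
have e : m.+1%:Z * 'C(m, a.+1)%:Z = (m%:Z - a%:Z) * 'C(m.+1, a.+1)%:Z :> int.
  by rewrite -PoszM -{1}[m]/(m.+1.-1) mul_bin_down subSS PoszM subzn.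
rewrite exprS addSn addSn exprS.
transitivity (- (-1) ^+ (m + a + 1) * a%:Z ^+ n *
  (m%:Z * 'C(m.+1, a.+1)%:Z - m.+1%:Z * 'C(m, a.+1)%:Z)); first by rewrite e; ring.
by ring.
Qed.

Lemma stirling_count0 m : stirling_count m.+1 0 = (-1) ^+ m.+1 * m%:Z.
Proof.
have : (1 - 1 : int) ^+ m.+1 = 0 by rewrite subrr expr0n.
rewrite exprDn -(big_mkord xpredT (fun i => (1 ^+ (m.+1 - i) * (-1) ^+ i) *+ 'C(m.+1, i))).
rewrite big_ltn // big_ltn // bin0 bin1 big_add1 /=.
rewrite !expr1n expr0 expr1 !mul1r mulr1n => h.
have {h} : \sum_(1 <= i < m.+1) (1 ^+ (m.+1 - i.+1) * (-1) ^+ i.+1) *+ 'C(m.+1, i.+1) = m%:Z.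
  move: h; set S := \sum_(_ <= _ < _) _; rewrite mulNrn natz intS => h.
  by apply/eqP; rewrite -subr_eq0 -h; apply/eqP; ring.
move=> <-; rewrite mulr_sumr; apply: eq_big_nat => a _.
rewrite expr1n mul1r expr0 mulr1 -mulr_natr natz mulrA -exprD.
by congr (_ * _); rewrite addn1 -addnS.
Qed.

(** Values below the diagonal count no cells, but the recursion for f(m, m) passes through f(m, m -
    1), which this evaluates to 1. *)
Lemma stirling_count_small m k : (0 < k < m)%N -> stirling_count m k = - (-1) ^+ (m + k).
Proof.
elim: k m => [//|k IH] [//|m] /= km; rewrite stirling_countS.
case: k IH km => [_|k IH] km.
  case: m km => // m _; rewrite !stirling_count0 addn1 !exprS !intS; ring.
rewrite !IH //=; last by rewrite ltnW.
by rewrite !addSn !addnS !exprS !intS; ring.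
Qed.

Lemma stirling_count_diag m : stirling_count m m = m`!%:Z - 1.
Proof.
elim: m => [|m IH]; first by rewrite /stirling_count big_geq.
case: m IH => [_|m IH]; first by rewrite /stirling_count big_geq // (_ : 1`! = 1%N).
rewrite stirling_countS IH stirling_count_small ?ltnSn // [in RHS]factS PoszM !addSn addnS addnn.
have -> : (-1) ^+ (m.*2.+3) = -1 :> int by rewrite -signr_odd /= odd_double.
by rewrite !intS; ring.
Qed.

Lemma size_cells (A : seq nat) k : sorted ltn A -> (size A <= k)%N ->
  (size (cells A k))%:Z = stirling_count (size A) k.
Proof.
elim: k A => [|k IH] A sA.
  by case: A sA => [|a A] _ // _; rewrite /stirling_count big_geq.
have uA := sorted_uniq_ltn sA; rewrite leq_eqVlt => /predU1P[Ak|Ak].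
  rewrite -{1}Ak cells_size size_map size_filter -Ak stirling_count_diag.
  have := count_predC (pred1 A) (permutations A).
  rewrite size_permutations // (count_uniq_mem _ (permutations_uniq _)) mem_permutations perm_refl.
  by move=> <-; rewrite add1n -[X in X.+1]addn0 -addSn PoszD /= -[_.+1]addn1 PoszD; ring.
rewrite ltnS in Ak; rewrite cellsS // size_cat size_allpairs size_allpairs_dep.
case: A sA uA Ak => [|a0 A] sA uA Ak; first by rewrite /stirling_count big_geq.
set B := a0 :: A in sA uA Ak *.
have sr i : i \in B -> (size (cells (rem i B) k))%:Z = stirling_count (size A) k.
  move=> iB; rewrite IH ?sorted_rem ?size_rem //.
  by rewrite (leq_trans (leq_pred _)).
rewrite [size B]/= stirling_countS PoszD PoszM IH // size_behead; congr (_ + _).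
rewrite sumnE big_map.
have -> : (\sum_(j <- B) size (cells (rem j B) k))%:Z =
    \sum_(j <- B) (size (cells (rem j B) k))%:Z :> int.
  by rewrite (big_morph Posz PoszD (erefl _)).
rewrite big_seq (eq_bigr (fun=> stirling_count (size A) k)) => [|i]; last exact: sr.
by rewrite -big_seq big_const_seq count_predT iter_addr_0 -mulr_natl natz.
Qed.

End Counting.

(** * Quotients and homotopy equivalences *)

(** A continuous surjection from a compact to a Hausdorff space stays a quotient map after taking
    the product with [Z], which homotopies need. By compactness it suffices to look near each [x]:
    if [q x = w], continuity of [f] decides, and otherwise [q x] and [w] have disjoint
    neighbourhoods and the condition is void. *)
Lemma compact_quotient_continuous (X W Y Z : topologicalType) (q : X -> W)
    (f : X * Z -> Y) (f' : W * Z -> Y) :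
  compact [set: X] -> hausdorff_space W -> continuous q ->
  (forall w, exists x, q x = w) -> continuous f ->
  (forall x z, f' (q x, z) = f (x, z)) -> continuous f'.
Proof.
move=> /compact_near_coveringP cX hW cq sq cf ff' [w z] V nV.
have h : \forall p \near nbhs (w, z),
    [set: X] `<=` (fun x => q x = p.1 -> V (f (x, p.2))).
  apply: (cX (W * Z)%type (nbhs (w, z)) (fun p x => q x = p.1 -> V (f (x, p.2)))) => x _.
  have [qx|qx] := pselect (q x = w).
    have nV' : nbhs (f (x, z)) V by rewrite -ff' qx.
    have [[P Q] [/= nP nQ] PQ] := cf (x, z) V nV'.
    exists (P, [set p : W * Z | Q p.2]) => /=.
      by split => //; exact: (@cvg_snd W Z (nbhs w) (nbhs z) _ _ nQ).
    by move=> [x' p] [/= Px Qp] _; exact: (PQ (x', p.2)).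
  apply: contra_notP qx => nn; apply: hW => P Q nP nQ.
  apply: contrapT => PQ0; apply: nn.
  exists (q @^-1` P, [set p : W * Z | Q p.1]) => /=.
    by split; [exact: cq|exact: (@cvg_fst W Z (nbhs w) (nbhs z) _ _ nQ)].
  move=> [x' p] [/= Px Qp] e; case: PQ0; exists (q x'); split => //.
  by rewrite e.
apply: (filterS _ h) => -[w' z'] hp; have [x qx] := sq w'.
by rewrite /= -qx ff'; exact: hp.
Qed.

Lemma set_val_SigSub (T : Type) (M : set T) (x : T) (h : x \in M) :
  set_val (SigSub h : M) = x.
Proof. by rewrite set_valE. Qed.

Section SetType.
Context {R : realType} {T U : topologicalType}.

Lemma set_val_continuous (M : set T) : continuous (set_val : M -> T).
Proof. exact: initial_continuous. Qed.

Lemma set_type_continuous (M : set T) (f : U -> M) :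
  continuous (set_val \o f) -> continuous f.
Proof. by move=> cf; apply: continuous_comp_initial. Qed.

Lemma cont_on_set_val (M : set T) (f : T -> U) : cont_on M f ->
  continuous (f \o (set_val : M -> T)).
Proof.
move=> cf; apply/cont_onT; apply: cont_on_comp cf _.
  by apply: continuous_cont_on; exact: set_val_continuous.
by move=> x _; exact: set_valP.
Qed.

Lemma homotopicP (f g : T -> U) :
  homotopic R f g <-> hmt R setT (fun _ _ => True) f g.
Proof.
split=> [[H [cH H0 H1]]|[H [cH _ H0 H1]]].
  by apply: (@hmt_unit _ _ _ _ _ _ _ H) => //; exact/cont_onP.
exists H; split; [|by move=> x; exact: H0|by move=> x; exact: H1].
by apply/cont_onP; apply: cont_onW cH => -[x t] [].
Qed.

End SetType.

Lemma hmt_homotopic (R : realType) (T U : topologicalType) (M : set T) (N : set U)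
    (P : T -> U -> Prop) (f0 g0 : T -> U) (f g : M -> N) :
  hmt R M P f0 g0 -> (forall x y, M x -> P x y -> N y) ->
  (forall x, set_val (f x) = f0 (set_val x)) ->
  (forall x, set_val (g x) = g0 (set_val x)) -> homotopic R f g.
Proof.
move=> [H [cH PH H0 H1]] PN fE gE; apply/homotopicP.
have NH (p : M * R) : H (set_val p.1, p.2) \in N.
  by apply/mem_set; apply: PN (PH _ _ _); exact: set_valP.
exists (fun p => SigSub (NH p)); split => //.
- rewrite setXTT; apply/cont_onT; apply: set_type_continuous.
  apply/cont_onT; apply: (cont_on_comp (f := fun p : M * R => (set_val p.1, p.2))) cH _.
    apply: cont_on_pair; last exact: cont_on_snd.
    apply: (cont_on_comp_cont (f := fst)); first exact: cont_on_fst.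
    exact: set_val_continuous.
  by move=> p _; split => //; exact: set_valP.
- by move=> x _; apply: val_inj; rewrite -set_valE fE -H0 //; exact: set_valP.
- by move=> x _; apply: val_inj; rewrite -set_valE gE -H1 //; exact: set_valP.
Qed.

Lemma homotopy_equivalent_trans (R : realType) (T U W : topologicalType) :
  homotopy_equivalent R T U -> homotopy_equivalent R U W -> homotopy_equivalent R T W.
Proof.
move=> [f [g [cf cg gf fg]]] [f' [g' [cf' cg' gf' fg']]].
exists (f' \o f), (g \o g'); split.
- by move=> x; apply: continuous_comp; [exact: cf|exact: cf'].
- by move=> x; apply: continuous_comp; [exact: cg'|exact: cg].
- apply/homotopicP; apply: (@hmt_trans _ _ _ _ _ (g \o f)); last exact/homotopicP.
  have /homotopicP h := gf'.
  have h1 := hmt_compr h (continuous_cont_on setT cf) (fun _ _ => I) (Q := fun _ _ => True).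
  exact: (hmt_compl (h1 (fun _ _ _ _ => I)) (continuous_cont_on setT cg)).
- apply/homotopicP; apply: (@hmt_trans _ _ _ _ _ (f' \o g')); last exact/homotopicP.
  have /homotopicP h := fg.
  have h1 := hmt_compr h (continuous_cont_on setT cg') (fun _ _ => I) (Q := fun _ _ => True).
  exact: (hmt_compl (h1 (fun _ _ _ _ => I)) (continuous_cont_on setT cf')).
Qed.

Lemma contractible_ctr (R : realType) (T : topologicalType) (B : set T) :
  contractible R B -> ctr R B.
Proof.
move=> [e /homotopicP[H [cH _ H0 H1]]]; exists (set_val e); first exact: set_valP.
(* The value off [B] is arbitrary, since continuity is only claimed within [B]. *)
pose K (p : T * R) : T :=
  if pselect (B p.1) is left Bx then set_val (H (SigSub (mem_set Bx), p.2)) else p.1.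
have KE (x : B) t : K (set_val x, t) = set_val (H (x, t)).
  rewrite /K; case: pselect => [Bx|[]]; last exact: set_valP.
  by congr (set_val (H (_, _))); apply: val_inj; rewrite /= set_valE.
exists K; split.
- move=> [x t] [/= Bx _] V nV.
  pose xs : B := SigSub (mem_set Bx).
  have xE : x = set_val xs by rewrite set_valE.
  have cH' : continuous H by apply/cont_onT; rewrite -setXTT.
  have cHT : continuous (set_val \o H).
    by move=> p; apply: continuous_comp; [exact: cH'|exact: set_val_continuous].
  rewrite xE KE in nV; have [[P Q] [/= nP nQ] PQ] := cHT (xs, t) V nV.
  move: nP => [_ [ [G oG <-] Gxs GP] ].
  have nG : nbhs x G by apply: open_nbhs_nbhs; split => //; rewrite xE.
  exists (G, Q) => //= -[y s] [/= Gy Qs] [/= By _].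
  have yE : y = set_val (SigSub (mem_set By) : B) by rewrite set_valE.
  rewrite /= {1}yE KE; apply: (PQ (_, s)); split => //=; apply: GP.
  by rewrite /= -yE.
- move=> x t Bx; have -> : x = set_val (SigSub (mem_set Bx) : B) by rewrite set_valE.
  by rewrite KE; exact: set_valP.
- move=> x Bx; have -> : x = set_val (SigSub (mem_set Bx) : B) by rewrite set_valE.
  by rewrite KE H0.
- move=> x Bx; have -> : x = set_val (SigSub (mem_set Bx) : B) by rewrite set_valE.
  by rewrite KE H1.
Qed.

(** * Spheres as quotients of cubes *)

Lemma cont_on_row (R : realType) (T : topologicalType) (k : nat) (A : set T)
    (f : T -> 'rV[R]_k) :
  (forall j, cont_on A (fun x => f x 0 j)) -> cont_on A f.
Proof.
move=> cf x Ax V [P nP PV].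
have h j : \forall y \near x, A y -> P 0 j (f y 0 j) := cf j x Ax _ (nP 0 j).
have hf : \forall y \near x, forall j, A y -> P 0 j (f y 0 j) by exact: filter_forall.
apply: (filterS _ hf) => y hy Ay; apply: PV => i j.
by rewrite ord1; exact: hy.
Qed.

Section SphereMap.
Context {R : realType} {k : nat}.
Implicit Types u v z : 'I_k -> R.

(** The sup norm, whose unit ball is the cube with sides [-1, 1]. For [k = 0] it is 0, so the
    one-point cube has no boundary and [theta] sends it to the point of the 0-sphere other than the
    base point. *)
Definition nrm u : R := \big[Num.max/0]_i `|u i|.

Lemma nrm_ge0 u : 0 <= nrm u.
Proof. by rewrite /nrm bigmax_ge_id. Qed.

Lemma le_nrm u i : `|u i| <= nrm u.
Proof. exact: le_bigmax. Qed.

Lemma nrm_leP u c : 0 <= c -> nrm u <= c <-> forall i, `|u i| <= c.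
Proof.
move=> c0; split=> [h i|h]; first exact: le_trans (le_nrm u i) h.
by apply/bigmax_leP; split.
Qed.

Lemma nrm_ltP u c : 0 < c -> nrm u < c <-> forall i, `|u i| < c.
Proof.
move=> c0; split=> [h i|h]; first exact: le_lt_trans (le_nrm u i) h.
by apply/bigmax_ltP; split.
Qed.

Lemma nrmZ c u : 0 <= c -> nrm (fun i => c * u i) = c * nrm u.
Proof.
rewrite le_eqVlt => /predU1P[<-|c0].
  by apply: le_anti; rewrite mul0r nrm_ge0 andbT; apply/nrm_leP => // i; rewrite mul0r normr0.
apply: le_anti; apply/andP; split.
  apply/nrm_leP; first by rewrite mulr_ge0 ?nrm_ge0 // ltW.
  by move=> i; rewrite normrM gtr0_norm // ler_pM2l // le_nrm.
rewrite mulrC -ler_pdivlMr //; apply/nrm_leP; first by rewrite divr_ge0 ?nrm_ge0 // ltW.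
move=> i; rewrite ler_pdivlMr //; apply: le_trans (le_nrm (fun i => c * u i) i).
by rewrite normrM gtr0_norm // mulrC.
Qed.

Let gap u : R := 1 - nrm u.
Let sq u : R := \sum_i u i ^+ 2.
Let den u : R := sq u + gap u ^+ 2.

(* The open cube is stretched onto [R^k] by [u / (1 - nrm u)] and then mapped by
   inverse stereographic projection; clearing denominators makes the formula
   continuous up to the boundary of the cube, which goes to the base point. *)
Definition theta u : 'rV[R]_k.+1 :=
  \row_j (if unlift ord0 j is Some i then 2 * gap u * u i / den u
          else (sq u - gap u ^+ 2) / den u).

Let sq_ge0 u : 0 <= sq u.
Proof. by apply: sumr_ge0 => i _; exact: sqr_ge0. Qed.

Let den_gt0 u : 0 < den u.
Proof.
rewrite lt_neqAle addr_ge0 ?sq_ge0 ?sqr_ge0 // andbT eq_sym.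
apply/negP; rewrite paddr_eq0 ?sq_ge0 ?sqr_ge0 // => /andP[s0].
rewrite sqrf_eq0 subr_eq0 => /eqP n1.
have u0 i : u i = 0.
  move: s0; rewrite psumr_eq0 => [/allP /(_ i)|j _]; last exact: sqr_ge0.
  by rewrite mem_index_enum => /(_ isT) /=; rewrite sqrf_eq0 => /eqP.
have : nrm u <= 0 by apply/nrm_leP => // i; rewrite u0 normr0.
by rewrite -n1 ler10.
Qed.

Let theta0 u : theta u 0 ord0 = (sq u - gap u ^+ 2) / den u.
Proof. by rewrite mxE unlift_none. Qed.

Let thetaS u i : theta u 0 (lift ord0 i) = 2 * gap u * u i / den u.
Proof. by rewrite mxE liftK. Qed.

Lemma theta_sphere u : theta u \in sphere R k.
Proof.
apply/mem_set; rewrite /sphere /= big_ord_recl theta0.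
under eq_bigr do rewrite thetaS.
have d0 := lt0r_neq0 (den_gt0 u).
have -> : \sum_(i < k) (2 * gap u * u i / den u) ^+ 2 = 4 * gap u ^+ 2 * sq u / den u ^+ 2.
  by rewrite /sq mulr_sumr mulr_suml; apply: eq_bigr => i _; rewrite !exprMn exprVn; ring.
by rewrite exprMn exprVn /den; field; exact: d0.
Qed.

Lemma cont_on_theta (T : topologicalType) (A : set T) (f : T -> 'I_k -> R) :
  (forall i, cont_on A (fun x => f x i)) -> cont_on A (fun x => theta (f x)).
Proof.
move=> cf; have cn : cont_on A (fun x => gap (f x)).
  apply: cont_onB; first exact: cont_on_cst.
  rewrite /nrm; elim: (index_enum _) => [|i r IH].
    by apply: cont_on_ext (cont_on_cst A (0 : R)) _ => x _; rewrite big_nil.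
  apply: (@cont_on_ext _ _ _ (fun x => Num.max `|f x i| (\big[Num.max/0]_(i <- r) `|f x i|))).
    by apply: cont_on_max => //; exact: cont_on_norm.
  by move=> x _; rewrite big_cons.
have csq : cont_on A (fun x => sq (f x)).
  by apply: cont_on_sum => i _; apply: cont_onM.
have cg2 : cont_on A (fun x => gap (f x) ^+ 2) by apply: cont_onM.
have cd : cont_on A (fun x => (den (f x))^-1).
  by apply: cont_onV => [|x _]; [exact: cont_onD|exact: lt0r_neq0].
apply: cont_on_row => j; rewrite /theta; case: (unliftP ord0 j) => [i|] ->.
  apply: (@cont_on_ext _ _ _ (fun x => 2 * gap (f x) * f x i / den (f x))).
    apply: cont_onM => //; apply: cont_onM => //; apply: cont_onM => //; exact: cont_on_cst.
  by move=> x _; rewrite mxE liftK.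
apply: (@cont_on_ext _ _ _ (fun x => (sq (f x) - gap (f x) ^+ 2) / den (f x))).
  by apply: cont_onM => //; exact: cont_onB.
by move=> x _; rewrite mxE unlift_none.
Qed.

Let one_theta0 u : 1 - theta u 0 ord0 = 2 * gap u ^+ 2 / den u.
Proof.
rewrite theta0; have d0 := lt0r_neq0 (den_gt0 u).
by rewrite -[1 in LHS](divff d0) -mulrBl; congr (_ / _); rewrite /den; ring.
Qed.

Lemma theta_base u : theta u = delta_mx 0 0 <-> nrm u = 1.
Proof.
have d0 := lt0r_neq0 (den_gt0 u); split=> [e|n1].
  have := one_theta0 u; rewrite e mxE !eqxx subrr => /esym /eqP.
  rewrite mulf_eq0 invr_eq0 (negPf d0) orbF mulf_eq0 pnatr_eq0 /= sqrf_eq0 subr_eq0.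
  by move/eqP.
have g0 : gap u = 0 by rewrite /gap n1 subrr.
have denE : den u = sq u by rewrite /den g0 expr0n addr0.
apply/rowP => j; case: (unliftP ord0 j) => [i|] ->.
  by rewrite thetaS g0 mulr0 !mul0r mxE eq_sym (negPf (neq_lift _ _)).
by rewrite theta0 g0 expr0n subr0 -denE divff // mxE !eqxx.
Qed.

(** The stereographic coordinates [u i / gap u] can be read off [theta u]. Their norm is
    [nrm u / (1 - nrm u)], which determines [nrm u] and then [u]. *)
Lemma theta_inj u v : nrm u < 1 -> nrm v < 1 -> theta u = theta v -> u =1 v.
Proof.
move=> u1 v1 uv.
have gu : 0 < gap u by rewrite subr_gt0.
have gv : 0 < gap v by rewrite subr_gt0.
have du := den_gt0 u; have dv := den_gt0 v.
have e0 : gap u ^+ 2 / den u = gap v ^+ 2 / den v.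
  have := one_theta0 u; rewrite uv one_theta0 -!mulrA => h.
  by apply: (@mulfI _ 2) => //; rewrite -h.
have z i : u i = gap u / gap v * v i.
  have : theta u 0 (lift ord0 i) = theta v 0 (lift ord0 i) by rewrite uv.
  rewrite !thetaS => h.
  have e : u i / gap u = v i / gap v.
    have -> : u i / gap u = (2 * gap u * u i / den u) / (2 * (gap u ^+ 2 / den u)).
      by field; rewrite ?lt0r_neq0.
    have -> : v i / gap v = (2 * gap v * v i / den v) / (2 * (gap v ^+ 2 / den v)).
      by field; rewrite ?lt0r_neq0.
    by rewrite h e0.
  by rewrite mulrAC -mulrA -e mulrC divfK // lt0r_neq0.
have nuv : nrm u = gap u / gap v * nrm v.
  rewrite -nrmZ ?divr_ge0 ?ltW //; congr nrm; exact/funext.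
have guv : gap u = gap v.
  have : nrm u * gap v = gap u * nrm v by rewrite nuv mulrAC divfK ?lt0r_neq0.
  by rewrite /gap; lra.
by move=> i; rewrite z guv divff ?mul1r // lt0r_neq0.
Qed.

Lemma theta_surj (y : 'rV[R]_k.+1) : y \in sphere R k -> y != delta_mx 0 0 ->
  exists2 u, nrm u < 1 & theta u = y.
Proof.
move=> /set_mem; rewrite /sphere /= big_ord_recl => ys yb.
pose S := \sum_(i < k) y 0 (lift ord0 i) ^+ 2.
have S0 : 0 <= S by apply: sumr_ge0 => i _; exact: sqr_ge0.
have {}ys : S = 1 - y 0 ord0 ^+ 2 by rewrite -ys addrC addKr.
have y1 : 0 < 1 - y 0 ord0.
  rewrite subr_gt0 lt_neqAle; apply/andP; split; last by nra.
  apply: contraNneq yb => y1; apply/eqP/rowP => j; case: (unliftP ord0 j) => [i|] ->.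
    have : S = 0 by rewrite ys y1 expr1n subrr.
    rewrite mxE eq_sym (negPf (neq_lift _ _)) => /eqP.
    rewrite psumr_eq0 => [/allP /(_ i)|l _]; last exact: sqr_ge0.
    by rewrite mem_index_enum => /(_ isT) /=; rewrite sqrf_eq0 => /eqP.
  by rewrite mxE !eqxx.
have y1' := lt0r_neq0 y1.
(* [z] is the stereographic projection of [y] from the base point; dividing it by [1 + nrm z]
   inverts the stretching [u / (1 - nrm u)]. *)
pose z i : R := y 0 (lift ord0 i) / (1 - y 0 ord0).
have n0 : 0 < 1 + nrm z by rewrite ltr_wpDr ?nrm_ge0.
have n0' := lt0r_neq0 n0.
pose u i := (1 + nrm z)^-1 * z i.
have nu : nrm u = nrm z / (1 + nrm z) by rewrite nrmZ 1?mulrC // invr_ge0 ltW.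
have gu : gap u = (1 + nrm z)^-1 by rewrite /gap nu; field.
have sqz : sq z = (1 + y 0 ord0) / (1 - y 0 ord0).
  have -> : sq z = S / (1 - y 0 ord0) ^+ 2.
    by rewrite /sq /S mulr_suml; apply: eq_bigr => i _; rewrite exprMn exprVn.
  by rewrite ys; field.
have squ : sq u = (1 + nrm z)^-1 ^+ 2 * sq z.
  by rewrite /sq mulr_sumr; apply: eq_bigr => i _; rewrite exprMn.
have denE : den u = (1 + nrm z)^-1 ^+ 2 * (2 / (1 - y 0 ord0)).
  by rewrite /den squ gu sqz; field; rewrite y1' n0'.
exists u; first by rewrite nu ltr_pdivrMr // mul1r; lra.
apply/rowP => j; case: (unliftP ord0 j) => [i|] ->.
  by rewrite thetaS denE gu /u /z; field; rewrite y1' n0'.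
by rewrite theta0 denE squ gu sqz; field; rewrite y1' n0'.
Qed.

End SphereMap.

(** * The model is a wedge of spheres *)

Section CellCoordinates.
Context {R : realType} {n k : nat} (w : seq (nat * bool)).
Local Notation E := {ptws 'I_n -> R}.
Local Notation letter := (nth (0%N, false) w).
Implicit Types x y : E.
Hypothesis size_w : size w = n.
Hypothesis edges_w : count snd w = k.
Hypothesis pos_w : {in w, forall l : nat * bool, l.2 -> (0 < l.1)%N}.

Let pos := [seq j <- iota 0 (size w) | (letter j).2].

Let size_pos : size pos = k.
Proof.
rewrite size_filter -edges_w -[in RHS](mkseq_nth (0%N, false) w) /mkseq count_map.
exact: eq_count.
Qed.

Let posP (i : 'I_k) : (nth 0%N pos i < n)%N /\ (letter (nth 0%N pos i)).2.
Proof.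
have : nth 0%N pos i \in pos by rewrite mem_nth // size_pos.
by rewrite mem_filter mem_iota add0n size_w => /andP[-> /andP[_ ->]].
Qed.

Let pred_letter j : (j < n)%N -> (letter j).2 -> (letter j).1.-1%:R = (letter j).1%:R - 1 :> R.
Proof.
move=> jn lj; have l0 : (0 < (letter j).1)%N by apply: pos_w => //; rewrite mem_nth // size_w.
by rewrite -[in RHS](prednK l0) -natr1 addrK.
Qed.

(** The [i]-th edge letter of [w], the edge from [a - 1] to [a], is rescaled affinely to [-1, 1]. *)
Definition cell_coord x (i : 'I_k) : R :=
  2 * (xcoord x (nth 0%N pos i) - (letter (nth 0%N pos i)).1%:R) + 1.

Lemma cell_coord_cont (T : topologicalType) (A : set T) (f : T -> E) i :
  cont_on A f -> cont_on A (fun p => cell_coord (f p) i).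
Proof.
move=> cf; apply: cont_onD; last exact: cont_on_cst.
apply: cont_onM; first exact: cont_on_cst.
by apply: cont_onB; [exact: cont_on_co|exact: cont_on_cst].
Qed.

Lemma cell_coord_le1 x : cclosed w x -> nrm (cell_coord x) <= 1.
Proof.
move=> cx; apply/nrm_leP => // i; have [jn lj] := posP i.
have := cx (nth 0%N pos i); rewrite size_w jn /lclosed lj pred_letter // => /(_ isT) /andP[h1 h2].
by rewrite ler_norml /cell_coord; lra.
Qed.

Lemma cell_coord_lt1 x : cclosed w x -> copen w x <-> nrm (cell_coord x) < 1.
Proof.
move=> cx; split=> [ox|h].
  apply/nrm_ltP => // i; have [jn lj] := posP i.
  have := ox (nth 0%N pos i); rewrite size_w jn /lopen lj pred_letter // => /(_ isT) /andP[h1 h2].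
  by rewrite ltr_norml /cell_coord; lra.
move=> j; rewrite size_w => jn; have := cx j; rewrite size_w jn /lclosed /lopen => /(_ isT).
case: ifP => // lj _; rewrite pred_letter //.
have jp : j \in pos by rewrite mem_filter lj mem_iota add0n size_w.
have ik : (index j pos < k)%N by rewrite -size_pos index_mem.
have /(nrm_ltP _ (ltr01 : 0 < 1 :> R)) /(_ (Ordinal ik)) := h.
by rewrite /cell_coord /= nth_index // ltr_norml; lra.
Qed.

Lemma cell_coord_inj x y : cclosed w x -> cclosed w y ->
  cell_coord x =1 cell_coord y -> x = y.
Proof.
move=> cx cy e; apply/funext => v; rewrite -!coord_ord; move: (val v) (ltn_ord v) => j jn.
have := cx j; have := cy j; rewrite size_w jn /lclosed => /(_ isT) + /(_ isT).
case: ifP => lj; last by move=> /eqP -> /eqP ->.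
have jp : j \in pos by rewrite mem_filter lj mem_iota add0n size_w.
have ik : (index j pos < k)%N by rewrite -size_pos index_mem.
have := e (Ordinal ik); rewrite /cell_coord /= nth_index // => ee _ _; lra.
Qed.

Lemma cell_coord_surj (u : 'I_k -> R) : nrm u <= 1 ->
  exists2 x, cclosed w x & cell_coord x =1 u.
Proof.
move=> u1; pose f j : R := (letter j).1%:R +
  if (letter j).2 then (if insub (index j pos) is Some i then (u i - 1) / 2 else 0) else 0.
pose x : E := fun v => f v.
have xE j : (j < n)%N -> xcoord x j = f j by move=> jn; rewrite /xcoord insubT.
have fE j : (j < n)%N -> (letter j).2 -> exists i, [/\ nth 0%N pos (i : 'I_k) = j &
    f j = (letter j).1%:R + (u i - 1) / 2].
  move=> jn lj; have jp : j \in pos by rewrite mem_filter lj mem_iota add0n size_w.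
  have ik : (index j pos < k)%N by rewrite -size_pos index_mem.
  by exists (Ordinal ik); split; [exact: nth_index|rewrite /f lj insubT].
exists x => [j|i].
  rewrite size_w => jn; rewrite xE // /lclosed; case: ifP => lj; last by rewrite /f lj addr0.
  have [i [_ ->]] := fE j jn lj; rewrite pred_letter //.
  by have := le_trans (le_nrm u i) u1; rewrite ler_norml; lra.
have [jn lj] := posP i; rewrite /cell_coord xE //; have [i' [e ->]] := fE _ jn lj.
suff -> : i' = i by lra.
have up : uniq pos by rewrite filter_uniq ?iota_uniq.
by apply: ord_inj; apply/eqP; rewrite -(nth_uniq 0%N _ _ up) ?size_pos // e.
Qed.

End CellCoordinates.

Section Wedge.
Context {I : choiceType} (X : I -> topologicalType) (p0 : forall i, X i).

(** The [i]-th coordinate in the product of the summands is [a] on one side; a point coming from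
    another summand has the base point there. *)
Lemma wedge_lift_inj i j (a : X i) (b : X j) :
  wedge_lift p0 a = wedge_lift p0 b -> a != p0 i -> Tagged X a = Tagged X b.
Proof.
move=> e a0; have : wedge_prod (wedge_lift p0 a) i = wedge_prod (wedge_lift p0 b) i by rewrite e.
rewrite /wedge_prod !wedge_lift_funE; try exact: wedge_prod_pointE.
rewrite dfwithin; have [ij|ij] := eqVneq j i.
  by subst j; rewrite dfwithin => ->.
by rewrite dfwithout // => ea; rewrite ea eqxx in a0.
Qed.

End Wedge.

Lemma cont_on_closed_fin (T U : topologicalType) (I : finType) (A : set T)
    (F : I -> set T) (f : T -> U) :
  (forall i, closed (F i)) -> (forall x, A x -> exists i, F i x) ->
  (forall i, cont_on (A `&` F i) f) -> cont_on A f.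
Proof.
move=> clF AF cf x Ax V nV.
have h i : \forall y \near x, A y -> F i y -> V (f y).
  have [Fx|nFx] := pselect (F i x).
    have n : \forall y \near x, (A `&` F i) y -> V (f y) := cf i x (conj Ax Fx) V nV.
    by apply: (filterS _ n) => y hy Ay Fy; exact: hy.
  have n : nbhs x (~` F i) by apply: open_nbhs_nbhs; split=> //; exact: closed_openC.
  by apply: filterS n => y nF _ /nF.
have hf : \forall y \near x, forall i, A y -> F i y -> V (f y) by exact: filter_forall.
by apply: (filterS _ hf) => y hy Ay; have [i Fi] := AF y Ay; exact: (hy i).
Qed.

Lemma compact_set_type (T : topologicalType) (M : set T) :
  compact M -> compact [set: M].
Proof.
move=> /compact_near_coveringP /near_covering_withinP cM.
apply/compact_near_coveringP => J F P FF h.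
have hM : \forall i \near F, M `<=` (fun t => forall x : M, set_val x = t -> P i x).
  apply: (cM J F (fun i t => forall x : M, set_val x = t -> P i x)) => t Mt.
  pose x : M := SigSub (mem_set Mt).
  have [[Q G] [/= nQ FG] QG] := h x I.
  move: nQ => [_ [ [B oB <-] Bx BQ] ].
  exists (B, G) => /=.
    by split => //; apply: open_nbhs_nbhs; split => //; move: Bx; rewrite /= set_valE.
  move=> [t' i] [/= Bt' Gi] Mt' y yt; apply: (QG (y, i)); split => //=; apply: BQ.
  by rewrite /= yt.
by apply: filterS hM => i hi x _; apply: hi; [exact: set_valP|].
Qed.

(** [W] is the quotient of [M] by [D], up to homeomorphism. As [g] is constant on [D], it factors
    through [q] and gives the inverse; as the homotopy to [g] keeps [D] in [D], it descends to [W].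
    The section [r] of [q] need not be continuous: continuity of maps built from it comes from
    [compact_quotient_continuous]. *)
Lemma collapse_equiv (R : realType) (T W : topologicalType) (M D : set T)
    (q : T -> W) (g : T -> T) :
  D `<=` M -> compact M -> hausdorff_space W -> cont_on M q ->
  (forall w, exists x, M x /\ q x = w) ->
  (forall x y, M x -> M y -> q x = q y -> x = y \/ (D x /\ D y)) ->
  (forall x y, D x -> D y -> q x = q y) ->
  hmt R M (fun x y => M y /\ (D x -> D y)) idfun g ->
  (forall x y, D x -> D y -> g x = g y) ->
  homotopy_equivalent R M W.
Proof.
move=> DM cM hW cq sq iq Dq idg Dg; have [cg Pg] := hmt_contr idg.
have Mg x : M x -> M (g x) by move=> /Pg[].
have /choice[r hr] := sq.
have rq (F : T -> W) x : M x -> (forall x y, D x -> D y -> F x = F y) -> F (r (q x)) = F x.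
  move=> Mx DF; have [Mr qr] := hr (q x).
  by have [->|[D1 D2]] := iq _ _ Mr Mx qr; last exact: DF.
have grq x : M x -> g (r (q x)) = g x.
  move=> Mx; have [Mr qr] := hr (q x).
  by have [->|[D1 D2]] := iq _ _ Mr Mx qr; last exact: Dg.
pose qX (x : M) := q (set_val x).
have cX := compact_set_type cM.
have cqX : continuous qX by exact: cont_on_set_val.
have sqX w : exists x, qX x = w.
  have [x [Mx qx]] := sq w; exists (SigSub (mem_set Mx)).
  by rewrite /qX set_valE.
have gX (x : M) : g (set_val x) \in M by apply/mem_set/Mg; exact: set_valP.
have GX w : g (r w) \in M by apply/mem_set/Mg; have [] := hr w.
pose G w : M := SigSub (GX w).
have Gq x : G (qX x) = SigSub (gX x).
  by apply: val_inj; rewrite /= grq //; exact: set_valP.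
have cG : continuous G.
  have cf' : continuous (fun p : W * R => G p.1).
    apply: (@compact_quotient_continuous _ _ _ _ qX
      (fun p : M * R => SigSub (gX p.1) : M)) => //.
      apply: set_type_continuous; apply/cont_onT.
      apply: (@cont_on_comp _ _ _ _ M (fun p : M * R => set_val p.1) g) cg _ => //.
        apply: (cont_on_comp_cont (f := fst)); first exact: cont_on_fst.
        exact: set_val_continuous.
      by move=> p _; exact: set_valP.
    by move=> x z; exact: Gq.
  apply/cont_onT; apply: (@cont_on_comp_cont _ _ _ _
    (fun w : W => (w, 0 : R)) (fun p : W * R => G p.1)) => //.
  by apply: cont_on_pair; [exact: cont_on_id|exact: cont_on_cst].
exists qX, G; split => //.
- apply: (hmt_homotopic (hmt_sym idg)).
  + by move=> x y _ [].
  + by move=> x; rewrite /= Gq; exact: set_val_SigSub.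
  + by [].
- apply/homotopicP; apply: hmt_sym; have [H [cH PH H0 H1]] := idg.
  exists (fun p => q (H (r p.1, p.2))); split => //=.
  + rewrite setXTT; apply/cont_onT.
    apply: (@compact_quotient_continuous _ _ _ _ qX
      (fun p : M * R => q (H (set_val p.1, p.2)))) => //.
      apply/cont_onT.
      apply: (@cont_on_comp _ _ _ _ M (fun p : M * R => H (set_val p.1, p.2)) q) cq _.
        apply: (@cont_on_comp _ _ _ _ (M `*` setT) (fun p : M * R => (set_val p.1, p.2)) H) cH _.
          apply: cont_on_pair; last exact: cont_on_snd.
          apply: (cont_on_comp_cont (f := fst)); first exact: cont_on_fst.
          exact: set_val_continuous.
        by move=> p _; split => //; exact: set_valP.
      by move=> p _; have [] := PH (set_val p.1) p.2 (set_valP _).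
    move=> x t /=; have Mx := set_valP x.
    apply: (rq (fun x => q (H (x, t)))) => // a b Da Db.
    by apply: Dq; [have [_] := PH a t (DM _ Da)|have [_] := PH b t (DM _ Db)]; exact.
  + by move=> w _; have [Mr qr] := hr w; rewrite H0.
  + by move=> w _; have [Mr qr] := hr w; rewrite H1 // /qX set_val_SigSub.
Qed.

Section Model.
Context {R : realType} {n : nat} (L : nat).
Local Notation E := {ptws 'I_n -> R}.
Implicit Types (x y : E) (A : seq nat).

Definition box : set E := [set x | forall v, 0 <= x v <= L%:R].

Definition boxc x : E := fun v => Num.max 0 (Num.min L%:R (x v)).

Lemma boxc_box x : box (boxc x).
Proof.
by move=> v; rewrite /boxc le_max lexx /= ge_max ler0n ge_min lexx.
Qed.

Lemma boxc_id x : box x -> boxc x = x.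
Proof.
by move=> bx; apply/funext => v; have /andP[h1 h2] := bx v; rewrite /boxc min_r // max_r.
Qed.

Lemma face_boxc x : face L x (boxc x).
Proof.
move=> v z zL; have zL' : z%:R <= L%:R :> R by rewrite ler_nat.
split=> h; rewrite /boxc; first by rewrite ge_max ler0n ge_min h orbT.
by rewrite le_max le_min zL' h orbT.
Qed.

Lemma boxc_continuous : continuous (boxc : E -> E).
Proof.
apply/cont_onT; apply: cont_on_ptws => v; apply: cont_on_max; first exact: cont_on_cst.
apply: cont_on_min; first exact: cont_on_cst.
by apply: (@cont_on_coord _ _ _ _ (idfun : E -> E)); exact: cont_on_id.
Qed.

Lemma box_cubical : cubical L box.
Proof.
move=> x y bx xy v; have /andP[h1 h2] := bx v.
by rewrite (xy v 0%N (leq0n _)).2 //= (xy v L (leqnn _)).1.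
Qed.

Lemma cubicalI (B C : set E) : cubical L B -> cubical L C -> cubical L (B `&` C).
Proof. by move=> cB cC x y [Bx Cx] xy; split; [exact: cB xy|exact: cC xy]. Qed.

(** [boxc] moves each point within its closed cell, so it maps [B] into itself and carries a
    contraction of [B] into the box, where compactness is available. *)
Lemma ctr_box (B : set E) : cubical L B -> ctr R B -> ctr R (B `&` box).
Proof.
move=> cB [e Be h]; have cl x : B x -> (B `&` box) (boxc x).
  by move=> Bx; split; [apply: cB Bx (face_boxc x)|exact: boxc_box].
exists (boxc e); first exact: cl.
have h' := hmt_compl (Q := fun _ => B `&` box) h (continuous_cont_on setT boxc_continuous)
  (fun _ _ _ _ => I) (fun _ y _ By => cl y By).
apply: hmtW h' _ _ _ _ => [x []//|//|x [_ bx]|//].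
by rewrite /= boxc_id.
Qed.

Lemma box_compact : compact box.
Proof.
apply: (@tychonoff _ (fun _ : 'I_n => R) (fun _ => [set t : R | 0 <= t <= L%:R])) => _.
have -> : [set t : R | 0 <= t <= L%:R] = `[0, L%:R]%classic.
  by apply/seteqP; split => t /=; rewrite in_itv.
exact: segment_compact.
Qed.

Lemma cclosed_cubical w : {in w, forall l : nat * bool, (l.1 <= L)%N} ->
  cubical L (cclosed w : set E).
Proof.
move=> wL x y cx xy j jw; have := cx j jw.
have lL : ((nth (0%N, false) w j).1 <= L)%N by apply: wL; exact: mem_nth.
rewrite /lclosed; case: ifP => _; last by move/eqP/(face_coordE xy lL)/eqP.
move=> /andP[h1 h2]; rewrite (face_coord j xy lL).1 // andbT.
exact: (face_coord j xy (leq_trans (leq_pred _) lL)).2.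
Qed.

Lemma cclosed_box w x : size w = n -> {in w, forall l : nat * bool, (l.1 <= L)%N} ->
  cclosed w x -> box x.
Proof.
move=> sw wL cx v; have vw : (v < size w)%N by rewrite sw.
have := cx v vw; rewrite coord_ord.
have lL : (nth (0%N, false) w v).1%:R <= L%:R :> R by rewrite ler_nat wL // mem_nth.
rewrite /lclosed; case: ifP => _.
  by move=> /andP[h1 h2]; rewrite (le_trans _ h1) ?(le_trans h2).
by move=> /eqP ->; rewrite ler0n.
Qed.

(** Supplies a summand [i0] in which the base point of the wedge can be written. *)
Lemma cells_gt0 A k : sorted ltn A -> (1 < size A)%N -> (size A <= k)%N ->
  (0 < size (cells A k))%N.
Proof.
move=> sA A2; elim: k => [|k IH]; first by rewrite leqn0 => /eqP e; rewrite e in A2.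
rewrite leq_eqVlt => /predU1P[<-|Ak].
  rewrite -ltz_nat size_cells // stirling_count_diag subr_gt0 ltz_nat.
  by apply: leq_trans A2 _; exact: fact_geq.
rewrite ltnS in Ak; rewrite cellsS // size_cat size_allpairs size_behead addn_gt0 muln_gt0.
by rewrite IH // andbT; case: (A) A2 => // a [].
Qed.

Lemma sphere_hausdorff k : hausdorff_space (sphere R k).
Proof.
move=> x y h; apply: val_inj; apply: (@norm_hausdorff R 'rV[R]_k.+1) => P Q nP nQ.
have cv := @set_val_continuous _ (sphere R k).
by have [z [Pz Qz]] := h _ _ (cv x P nP) (cv y Q nQ); exists (set_val z).
Qed.

Theorem model_wedge A : sorted ltn A -> {in A, forall a, (a <= L)%N} ->
  (1 < size A)%N -> (size A <= n)%N ->
  homotopy_equivalent R (hits A n `&` box : set E)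
    (wedge_of_spheres R (size (cells A n)) (n - size A)).
Proof.
move=> sA AL A2 An; set N := size _; set k := (n - size A)%N.
set M := hits A n `&` box; pose D : set E := core A n `&` box.
have uA := sorted_uniq_ltn sA.
have N0 : (0 < N)%N by exact: cells_gt0.
pose i0 : 'I_N := Ordinal N0.
pose W (i : 'I_N) := nth [::] (cells A n) i.
have WA i : W i \in cells A n by rewrite mem_nth.
have Wsize i : size (W i) = n by have [] := cells_props sA (WA i).
have Wcount i : count snd (W i) = k.
  by have [_ h _ _] := cells_props sA (WA i); rewrite /k -[in RHS]h addnK.
have Wpos i : {in W i, forall l : nat * bool, l.2 -> (0 < l.1)%N}.
  by have [] := cells_props sA (WA i).
have WL i : {in W i, forall l : nat * bool, (l.1 <= L)%N}.
  by have [_ _ h _] := cells_props sA (WA i); move=> l /h; exact: AL.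
have WM i x : cclosed (W i) x -> M x.
  move=> cx; split; first exact: cells_hits (WA i) cx.
  exact: cclosed_box (Wsize i) (WL i) cx.
(* A point of the closed cell outside [D] lies in some open removed cell, which has the same
   dimension and so is the open cell of [W i] by [cell_face]. *)
have Wcore i x : cclosed (W i) x -> copen (W i) x <-> ~ D x.
  move=> cx; have [hx bx] := WM i x cx; split.
    by move=> /(copen_core sA (WA i)) nc [].
  move=> nD; have [|w wA ow] := cells_cover sA hx; first by move=> c; apply: nD.
  have [sw cw _ _] := cells_props sA wA.
  rewrite (@cell_face R n (W i) w x) ?Wsize ?Wcount //.
  by rewrite /k -[in LHS]cw addnK.
have Wuniq i j x : cclosed (W i) x -> cclosed (W j) x -> ~ D x -> i = j.
  move=> cx cj nD; apply: ord_inj; apply/eqP.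
  rewrite -(nth_uniq [::] (ltn_ord i : _ < size (cells A n))%N (ltn_ord j) (cells_uniq n sA)).
  apply/eqP; apply: (@cell_face R n (W i) (W j) x); rewrite ?Wsize ?Wcount //.
  exact/(Wcore j x cj).
have Wcover x : M x -> ~ D x -> exists i, cclosed (W i) x.
  move=> [hx bx] nD; have [|w wA ow] := cells_cover sA hx; first by move=> c; apply: nD.
  have wN : (index w (cells A n) < N)%N by rewrite index_mem.
  by exists (Ordinal wN); rewrite /W /= nth_index //; exact: copenW.
pose cc i x : 'I_k -> R := @cell_coord R n k (W i) x.
pose sp i x : sphere R k := SigSub (theta_sphere (cc i x)).
pose lift (i : 'I_N) (y : sphere R k) : wedge_of_spheres R N k :=
  @wedge_lift _ _ (fun _ : 'I_N => sphere_base R k) i y.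
have lift0 i j : lift i (sphere_base R k) = lift j (sphere_base R k).
  exact: (@wedge_liftE _ _ (fun _ : 'I_N => sphere_base R k)
    j (sphere_base R k) i (sphere_base R k)).
have ccle i x : cclosed (W i) x -> nrm (cc i x) <= 1.
  by move=> cx; apply: cell_coord_le1.
have spD i x : cclosed (W i) x -> sp i x = sphere_base R k <-> D x.
  move=> cx; have ccl : copen (W i) x <-> nrm (cc i x) < 1 by apply: cell_coord_lt1.
  have le1 := ccle i x cx; split=> [e|Dx].
    apply: contrapT => /(Wcore i x cx)/ccl; have : theta (cc i x) = delta_mx 0 0.
      exact: (congr1 val e).
    by move=> /theta_base ->; rewrite ltxx.
  apply: val_inj => /=; apply/theta_base; apply: le_anti; rewrite le1 leNgt.
  by apply/negP => /ccl /(Wcore i x cx).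
(* The cell is unique by [Wuniq], so choosing it is harmless. On [D], which contains the boundaries
   of the cells, all summands give the base point; hence [qW] holds on whole closed cells. *)
pose q x : wedge_of_spheres R N k :=
  if pselect (exists i, cclosed (W i) x /\ ~ D x) is left h
  then lift (projT1 (cid h)) (sp (projT1 (cid h)) x) else lift i0 (sphere_base R k).
have qD x : D x -> q x = lift i0 (sphere_base R k).
  by move=> Dx; rewrite /q; case: pselect => // h; have [i [_ nD]] := h; case: (nD Dx).
have qW i x : cclosed (W i) x -> q x = lift i (sp i x).
  move=> cx; have [Dx|nD] := pselect (D x).
    by rewrite qD // (spD i x cx).2 //; exact: lift0.
  rewrite /q; case: pselect => [h|[]]; last by exists i.
  case: cid => j [cj _] /=; by have -> : j = i by exact: (Wuniq j i x).
have Dctr : ctr R D by apply: ctr_box; [exact: core_cubical|exact: (core_ctr sA AL)].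
have [d0 Dd0 _] := Dctr.
have Mcub : cubical L M by apply: cubicalI; [exact: hits_cubical|exact: box_cubical].
have Dcub : cubical L D by apply: cubicalI; [exact: core_cubical|exact: box_cubical].
have DM : D `<=` M by move=> x [cx bx]; split => //; exact: core_hits.
have [u [h ndr]] := cubical_ndr Dcub Mcub DM (ex_intro _ d0 Dd0).
have D1 : \bigcup_(_ in [set: unit]) D = D.
  by apply/seteqP; split => x => [[]//|Dx]; exists tt.
(* The family has the single member [D], indexed by [unit]. *)
have [|||g [e [idg ge]]] := @ndr_collapse R E unit tt d0 M (fun=> D) u h.
- by rewrite D1.
- by move=> [] x _; apply: (@filterS _ (nbhs x) _ setT); [move=> y _ []|exact: filterT].
- by move=> [] _; exact: Dctr.
apply: (@collapse_equiv R E _ M D q g) => //.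
- apply: (subclosed_compact _ box_compact); first exact: cubical_closed Mcub.
  by move=> x [].
- by apply: wedge_hausdorff => _; exact: sphere_hausdorff.
- apply: (@cont_on_closed_fin _ _ (option 'I_N) _
    (fun o => if o is Some i then cclosed (W i) else D)).
  + case=> [i|]; last exact: cubical_closed Dcub.
    by apply: (@cubical_closed _ _ L); exact: cclosed_cubical.
  + move=> x Mx; have [Dx|nD] := pselect (D x); first by exists None.
    by have [i cx] := Wcover x Mx nD; exists (Some i).
  + case=> [i|]; last first.
      by apply: cont_on_ext (cont_on_cst _ (lift i0 (sphere_base R k))) _ => x [_ /qD].
    apply: (@cont_on_ext _ _ _ (lift i \o sp i)); last by move=> x [_ /qW ->].
    apply: (@cont_on_comp_cont _ _ _ _ (sp i) (lift i)); last first.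
      exact: (@wedge_lift_continuous _ _ (fun _ : 'I_N => sphere_base R k) i).
    apply: continuous_cont_on; apply: set_type_continuous; apply/cont_onT.
    apply: (@cont_on_theta R k _ _ (cc i)) => j.
    by apply: (cell_coord_cont (f := idfun)); exact: cont_on_id.
- move=> z; have : (\bigcup_i (@wedge_lift _ _ (fun _ : 'I_N => sphere_base R k) i) @` setT) z.
    by rewrite wedgeTE.
  move=> [i _ [y _ <-]]; have [yb|yb] := eqVneq y (sphere_base R k).
    by exists d0; split; [exact: DM|rewrite qD // yb; exact: lift0].
  have [||v v1 ve] := @theta_surj R k (\val y); first exact: valP.
    by apply: contraNneq yb => yv; apply/eqP; apply: val_inj.
  have [x cx xv] := @cell_coord_surj R n k (W i) (Wsize i) (Wcount i) (Wpos i) v (ltW v1).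
  exists x; split; first exact: WM cx.
  rewrite (qW i x cx) /lift; congr wedge_lift; apply: val_inj => /=.
  by rewrite -ve; congr theta; exact/funext.
- have key x y : M x -> M y -> q x = q y -> ~ D x -> x = y.
    move=> Mx My exy nD; have [i cx] := Wcover x Mx nD.
    have sx : sp i x != sphere_base R k by apply/eqP => /(spD i x cx).
    have [Dy|nDy] := pselect (D y).
      move: exy; rewrite (qW i x cx) (qD y Dy) (lift0 i0 i) => /wedge_lift_inj /(_ sx) et.
      by move: sx; rewrite (existT_inj2 et) eqxx.
    have [j cy] := Wcover y My nDy; move: exy; rewrite (qW i x cx) (qW j y cy).
    move=> /wedge_lift_inj /(_ sx) et; have ij : i = j := existT_inj1 et; subst j.
    have eth : theta (cc i x) = theta (cc i y) := congr1 val (existT_inj2 et).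
    apply: (@cell_coord_inj R n k (W i)) => //.
    apply: theta_inj eth; apply: (cell_coord_lt1 _ _ _ _).1 => //; exact/Wcore.
  move=> x y Mx My exy; have [Dx|nD] := pselect (D x); last by left; exact: key.
  have [Dy|nDy] := pselect (D y); first by right.
  by left; apply/esym/key.
- by move=> x y /qD -> /qD ->.
- by apply: hmtW idg _ _ _ _ => // x y _ [My h']; split => //; exact: (h' tt).
- by move=> x y /(ge tt)[-> _] /(ge tt)[-> _].
Qed.

End Model.

(** * Stirling complexes *)

Lemma homotopy_equivalent_sets (R : realType) (T U : topologicalType) (A : set T)
    (B : set U) (f : T -> U) (g : U -> T) :
  cont_on A f -> (forall x, A x -> B (f x)) ->
  cont_on B g -> (forall y, B y -> A (g y)) ->
  hmt R A (fun _ => A) (g \o f) idfun -> hmt R B (fun _ => B) (f \o g) idfun ->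
  homotopy_equivalent R A B.
Proof.
move=> cf AB cg BA gf fg.
have fB (x : A) : f (set_val x) \in B by apply/mem_set/AB; exact: set_valP.
have gA (y : B) : g (set_val y) \in A by apply/mem_set/BA; exact: set_valP.
exists (fun x => SigSub (fB x)), (fun y => SigSub (gA y)); split.
- by apply: set_type_continuous; exact: cont_on_set_val.
- by apply: set_type_continuous; exact: cont_on_set_val.
- apply: (hmt_homotopic gf) => [//|x|//].
  by apply: etrans (set_val_SigSub _) _; congr g; exact: set_val_SigSub.
- apply: (hmt_homotopic fg) => [//|x|//].
  by apply: etrans (set_val_SigSub _) _; congr f; exact: set_val_SigSub.
Qed.

Section Stirling.
Context {R : realType} {V : finType} (X : simplicial_complex V).
Context {m n : nat} (S : 'I_m -> simplicial_complex V).
Hypothesis SX : forall i, subcomplex (S i) X.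
Hypothesis disjS : forall i j, i != j -> [disjoint faces (S i) & faces (S j)]%B.
Local Notation E := {ptws V -> R}.
Local Notation XT := (set_type (realization R X)).
Local Notation Str := (stirling_complex (fun i => subrealization R X (S i)) n).

Lemma realization_face i v (x : E) : realization R (S i) x -> x v != 0 ->
  [set v]%SET \in faces (S i).
Proof.
move=> [_ _ fx] xv; apply: (face_sub fx); last by apply/set0Pn; exists v; rewrite inE.
by rewrite finset.sub1set inE.
Qed.

Lemma vertex_disj i j v : [set v]%SET \in faces (S i) -> [set v]%SET \in faces (S j) -> i = j.
Proof.
move=> vi vj; apply/eqP; apply: contraTT (vj) => ij.
by have /disjointFr := disjS ij; move/(_ _ vi) ->.
Qed.

Lemma realization_disj i j (x : E) : realization R (S i) x -> realization R (S j) x -> i = j.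
Proof.
move=> Si Sj; have [_ x1 _] := Si.
have /set0Pn[v] := supp_neq0 x1; rewrite inE => xv.
exact: vertex_disj (realization_face Si xv) (realization_face Sj xv).
Qed.

(** By disjointness each coordinate lies in at most one [S i], so one index tuple records all of
    them, with index 0 for a coordinate lying in none. *)
Lemma stirling_complexP (x : {ptws 'I_n -> XT}) : Str x <->
  forall i : 'I_m, exists k, realization R (S i) (set_val (x k)).
Proof.
split=> [[i hi hx] j|h].
  have j0 : lift ord0 j != ord0 by rewrite eq_sym neq_lift.
  have [k _ ik] := hi (lift ord0 j) j0.
  by exists k; have := hx k; rewrite /with_total ik liftK.
pose P k j := realization R (S j) (set_val (x k)).
have /choice[i hi] : forall k, exists i : 'I_m.+1,
    (forall j, P k j -> i = lift ord0 j) /\ with_total (fun i => subrealization R X (S i)) i (x k).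
  move=> k; have [[j Pj]|nP] := pselect (exists j, P k j).
    exists (lift ord0 j); split; last by rewrite /with_total liftK.
    by move=> j' Pj'; rewrite (realization_disj Pj Pj').
  exists ord0; split; last by rewrite /with_total unlift_none.
  by move=> j Pj; case: nP; exists j.
exists i; last by move=> k; have [] := hi k.
move=> j /= j0; have [j' ->] : exists j', j = lift ord0 j'.
  by case: (unliftP ord0 j) j0 => [j' ->|->]; [exists j'|rewrite eqxx].
by have [k Pk] := h j'; exists k => //; have [h' _] := hi k; rewrite (h' j' Pk).
Qed.

(** Extended linearly by [height], this takes the value [i] on all of [S i]. Vertices in no [S i]
    get 0, which keeps the height between 0 and [m - 1]. *)
Let label v : R := if [pick i | [set v]%SET \in faces (S i)] is Some i then i%:R else 0.

Definition height (x : E) : R := \sum_v x v * label v.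

Lemma height_cont (B : set E) : cont_on B height.
Proof.
apply: cont_on_sum => v _; apply: cont_onM; last exact: cont_on_cst.
by apply: (@cont_on_coord _ _ _ _ (idfun : E -> E)); exact: cont_on_id.
Qed.

Lemma height_face i (x : E) : realization R (S i) x -> height x = i%:R.
Proof.
move=> Si; have [_ x1 _] := Si; rewrite /height.
have -> : i%:R = \sum_v x v * i%:R by rewrite -mulr_suml x1 mul1r.
apply: eq_bigr => v _; have [->|xv] := eqVneq (x v) 0; first by rewrite !mul0r.
have vi := realization_face Si xv; rewrite /label; case: pickP => [j vj|/(_ i)].
  by rewrite (vertex_disj vi vj).
by rewrite vi.
Qed.

Lemma height_bound (x : E) : realization R X x -> 0 <= height x <= m.-1%:R.
Proof.
move=> [x0 x1 _]; have lb v : 0 <= label v <= m.-1%:R.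
  rewrite /label; case: pickP => [i _|_]; last by rewrite lexx ler0n.
  by rewrite ler0n ler_nat -ltnS prednK // (leq_ltn_trans _ (ltn_ord i)).
apply/andP; split; first by apply: sumr_ge0 => v _; rewrite mulr_ge0 //; have /andP[] := lb v.
have -> : m.-1%:R = \sum_v x v * m.-1%:R by rewrite -mulr_suml x1 mul1r.
apply: ler_sum => v _.
by rewrite ler_wpM2l //; have /andP[] := lb v.
Qed.

Lemma stirling_model : contractible R XT ->
  (forall i, contractible R (set_type (realization R (S i)))) -> (0 < m)%N ->
  homotopy_equivalent R (set_type Str)
    (hits (iota 0 m) n `&` box m.-1 : set {ptws 'I_n -> R}).
Proof.
move=> /contractible_ctr ctrX ctrS m0.
pose FF := [set s | [exists i, s \in faces (S i)]]%SET.
have dF : down_closed FF.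
  move=> s t; rewrite !inE => /existsP[i si] ts t0; apply/existsP; exists i.
  exact: face_sub si ts t0.
have dX : down_closed (faces X) by move=> s t; exact: face_sub.
have FX : FF \subset faces X.
  by apply/fintype.subsetP => s; rewrite inE => /existsP[i]; exact: (fintype.subsetP (SX i)).
have bigE : \bigcup_i realization R (S i) = geom FF.
  apply/seteqP; split=> x.
    by move=> [i _ [x0 x1 fx]]; split => //; rewrite inE; apply/existsP; exists i.
  by move=> [x0 x1]; rewrite inE => /existsP[i fx]; exists i.
have ctrS' i : ctr R (realization R (S i)) by apply: contractible_ctr; exact: ctrS.
have F0 : @geom R V FF !=set0.
  by have [x Sx _] := ctrS' (Ordinal m0); exists x; rewrite -bigE; exists (Ordinal m0).
have [u [h ndr]] := geom_ndr dF dX FX F0; rewrite -bigE in ndr.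
have [G [cG BG Gi [K [cK PK K0 K1]]]] :=
  tuple_equiv m0 ndr ctrX ctrS' (height_cont (B := _)) height_face.
pose f (x : {ptws 'I_n -> XT}) : {ptws 'I_n -> R} := fun k => height (set_val (x k)).
have GX t : G t \in realization R X by apply/mem_set; exact: BG.
pose g (y : {ptws 'I_n -> R}) : {ptws 'I_n -> XT} := fun k => SigSub (GX (y k)).
have KX (p : XT * R) : K (set_val p.1, p.2) \in realization R X.
  by apply/mem_set; have [] := PK (set_val p.1) p.2 (set_valP _).
have cKX : continuous (fun p : XT * R => SigSub (KX p) : XT).
  apply: set_type_continuous; apply/cont_onT.
  apply: (cont_on_comp (f := fun p : XT * R => (set_val p.1, p.2))) cK _.
    apply: cont_on_pair; last exact: cont_on_snd.
    apply: (cont_on_comp_cont (f := fst)); first exact: cont_on_fst.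
    exact: set_val_continuous.
  by move=> p _; split => //; exact: set_valP.
have cgX : continuous (fun t => SigSub (GX t) : XT).
  exact: set_type_continuous.
have chX : continuous (fun x : XT => height (set_val x)).
  by apply: (cont_on_set_val (f := height)); exact: height_cont.
have fhits x : Str x -> hits (iota 0 m) n (f x).
  move=> /stirling_complexP h' i; rewrite mem_iota add0n => /= im.
  have [k Sk] := h' (Ordinal im); exists k => //.
  by rewrite coord_ord /f (height_face Sk).
have hitsP (y : {ptws 'I_n -> R}) : hits (iota 0 m) n y <->
    forall i : 'I_m, exists k, y k = i%:R.
  split=> [h' i|h' i].
    have [|j jn e] := h' i; first by rewrite mem_iota add0n /=.
    by exists (Ordinal jn); rewrite -e /xcoord insubT.
  rewrite mem_iota add0n => /= im; have [k e] := h' (Ordinal im).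
  by exists k => //; rewrite coord_ord e.
apply: (@homotopy_equivalent_sets R _ _ Str _ f g).
- apply: cont_on_ptws => k; apply: (@cont_on_comp_cont _ _ _ _
    (fun x : {ptws 'I_n -> XT} => x k) (fun x : XT => height (set_val x))) => //.
  by apply: (@cont_on_coord _ _ _ _ idfun); exact: cont_on_id.
- move=> x Sx; split; first exact: fhits.
  by move=> k; apply: height_bound; exact: set_valP.
- apply: cont_on_ptws => k; apply: (@cont_on_comp_cont _ _ _ _
    (fun y : {ptws 'I_n -> R} => y k) (fun t => SigSub (GX t) : XT)) => //.
  by apply: (@cont_on_coord _ _ _ _ idfun); exact: cont_on_id.
- move=> y [/hitsP hy _]; apply/stirling_complexP => i; have [k e] := hy i.
  by exists k; rewrite set_val_SigSub e; exact: Gi.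
- exists (fun p k => SigSub (KX (p.1 k, p.2))); split.
  + apply: cont_on_ptws => k.
    apply: (@cont_on_comp_cont _ _ _ _ (fun p : {ptws 'I_n -> XT} * R => (p.1 k, p.2))
      (fun p : XT * R => SigSub (KX p) : XT)) => //.
    apply: cont_on_pair; last exact: cont_on_snd.
    by apply: (@cont_on_coord _ _ _ _ (fst : {ptws 'I_n -> XT} * R -> _)); exact: cont_on_fst.
  + move=> x t /stirling_complexP Sx; apply/stirling_complexP => i; have [k Sk] := Sx i.
    exists k; rewrite set_val_SigSub /=.
    by have [_ h'] := PK _ t (set_valP (x k)); exact: h'.
  + move=> x _; apply/funext => k; apply: val_inj => /=; rewrite K0 //.
    exact: set_valP.
  + move=> x _; apply/funext => k; apply: val_inj => /=; rewrite K1 -?set_valE //.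
    exact: set_valP.
(* On the model side a straight line suffices: [height (G i)] is [i] for a marked point, so a
   coordinate equal to [i] does not move, and the box is convex. *)
- apply: (@hmt_unit _ _ _ _ _ _ _ (fun p : {ptws 'I_n -> R} * R =>
    (fun k => (1 - p.2) * f (g p.1) k + p.2 * p.1 k) : {ptws 'I_n -> R})).
  + have cp k : cont_on ((hits (iota 0 m) n `&` box m.-1) `*` `[0, 1] : set ({ptws 'I_n -> R} * R))
        (fun p : {ptws 'I_n -> R} * R => p.1 k).
      by apply: (@cont_on_coord _ _ _ _ (fst : {ptws 'I_n -> R} * R -> _)); exact: cont_on_fst.
    apply: cont_on_ptws => k; apply: cont_onD; apply: cont_onM => //; last exact: cont_on_snd.
      by apply: cont_onB; [exact: cont_on_cst|exact: cont_on_snd].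
    apply: (@cont_on_comp_cont _ _ _ _ (fun p : {ptws 'I_n -> R} * R => p.1 k)
      (fun t => height (set_val (SigSub (GX t) : XT)))) => //.
    move=> t; apply: (@continuous_comp _ _ _ (fun t => SigSub (GX t) : XT)
      (fun x : XT => height (set_val x))); [exact: cgX|exact: chX].
  + move=> y t [/hitsP hy bx] t0 t1; split.
      apply/hitsP => i; have [k e] := hy i; exists k => /=.
      rewrite /f /g set_val_SigSub e (height_face (Gi i)) mulrBl mul1r subrK //.
    move=> k /=; have /andP[b1 b2] := bx k.
    have /andP[c1 c2] := height_bound (BG (y k)).
    rewrite /f /g set_val_SigSub; apply/andP; split; nra.
  + by move=> y _; apply/funext => k /=; rewrite subr0 mul1r mul0r addr0.
  + by move=> y _; apply/funext => k /=; rewrite subrr mul1r mul0r add0r.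
Qed.

End Stirling.

Local Close Scope classical_set_scope.
Unset Implicit Arguments.

Theorem theoremA1 (R : realType) (V : finType) (X : simplicial_complex V)
    (m n : nat) (S : 'I_m -> simplicial_complex V) :
  contractible R (set_type (realization R X)) ->
  (2 <= m)%N ->
  (forall i, subcomplex (S i) X) ->
  (forall i, contractible R (set_type (realization R (S i)))) ->
  (forall i j, i != j -> [disjoint faces (S i) & faces (S j)]) ->
  (m <= n)%N ->
  exists N : nat,
    N%:Z = stirling_count m n /\
    homotopy_equivalent R
      (set_type (stirling_complex (fun i => subrealization R X (S i)) n))
      (wedge_of_spheres R N (n - m)).
Proof.
move=> ctrX m2 SX ctrS disjS mn.
have sA := iota_ltn_sorted 0 m; have szA := size_iota 0 m.
exists (size (cells (iota 0 m) n)); split; first by rewrite size_cells ?szA.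
apply: homotopy_equivalent_trans (stirling_model SX disjS ctrX ctrS (ltnW m2)) _.
(* With [A = iota 0 m], the bound [m.-1] is the largest marked point. *)
have := @model_wedge R n m.-1 (iota 0 m) sA; rewrite szA; apply => // a.
by rewrite mem_iota add0n -[X in (a < X)%N](prednK (ltnW m2)) ltnS.
Qed.
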